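(* Let $\mathcal K:=\{g\in\breve{\mathcal C}:\ \sigma(g)\ge\frac15,\ \int g\ge\frac15\}$. Then: (a) $T(\mathcal K)\subseteq\mathcal K\cap\breve{\mathcal D}^\sharp$; (b) for each $f\in\mathcal E$ there exists $n\in\mathbb N$ with $T^nf\in\mathcal K$; (c) $d_1(f,g)\le d_\infty(f,g)\le5\sqrt{d_1(f,g)}$ for all $f,g\in\mathcal K$; (d) the metric spaces $(\mathcal K,d_\infty)$ and $(\mathcal K,d_1)$ are complete; (e) the restriction $T|_{\mathcal K}\colon\mathcal K\to\mathcal K$ is continuous when domain and codomain are each equipped, independently, with $d_\infty$ or $d_1$; (f) every sequence in $(\mathcal K,d_\infty)$ or in $(\mathcal K,d_1)$ has a convergent subsequence.
   Context: ''Decreasing'' means non-increasing; $\int f:=\int_0^1 f(x)\,dx$. $\mathcal E$: measurable decreasing $f\colon[0,1]\to[0,\infty)$ with $f(0)=1$ and $\int f>0$. $\mathcal C$: continuous $f\in\mathcal E$ with $f(1)=0$; $\breve{\mathcal C}$: convex $f\in\mathcal C$. $\mathcal D$: strictly decreasing $f\in\mathcal C$. $\mathcal D'$: $f\in\mathcal D$ continuously differentiable on $(0,1]$. $\mathcal D^\sharp$: $f\in\mathcal D'$ with $f'(1)=0$ and $\lim_{x\to0}f'(x)$ existing in $(-\infty,0]$; $\breve{\mathcal D}^\sharp:=\mathcal D^\sharp\cap\breve{\mathcal C}$. For $g\in\breve{\mathcal C}$, the stride is $\sigma(g):=\sup\{\alpha\ge0:\ \alpha-x\le\alpha g(x)\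 \forall x\in[0,1]\}$. For $g\in\mathcal E$, $g^*(y):=\sup\{x\in[0,1]:g(x)\ge y\}$. $T$ on $\mathcal E$: $(Tf)(x)=\frac{\int_x^1f^*}{\int f}$, $T^n=T\circ T^{n-1}$. Metrics on $\mathcal E$: $d_\infty(f,g):=\sup_{x\in[0,1]}|f(x)-g(x)|$ and $d_1(f,g):=\int_0^1|f-g|$. $\mathbb N=\{1,2,\dots\}$. *)

(* Defs.v *)
(* Stdlib reals + Coquelicot. Functions on [0,1] are represented as
   R -> R; only their values on [0,1] are ever inspected. *)
From Stdlib Require Import Reals.
From Coquelicot Require Import Coquelicot.
Open Scope R_scope.

Definition I01 (x : R) : Prop := 0 <= x <= 1.

(* int f := int_0^1 f(x) dx  (Riemann integral; decreasing functions on [0,1]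
   are Riemann integrable, and the integral coincides with Lebesgue's) *)
Definition integ (f : R -> R) : R := RInt f 0 1.

Definition inE (f : R -> R) : Prop :=
  (forall x y, 0 <= x -> x <= y -> y <= 1 -> f y <= f x) /\
  (forall x, I01 x -> 0 <= f x) /\
  f 0 = 1 /\
  0 < integ f.

Definition cont01 (f : R -> R) : Prop :=
  forall x, I01 x -> forall eps, 0 < eps -> exists delta, 0 < delta /\
    forall y, I01 y -> Rabs (y - x) < delta -> Rabs (f y - f x) < eps.

Definition inC (f : R -> R) : Prop := inE f /\ cont01 f /\ f 1 = 0.

Definition convex01 (f : R -> R) : Prop :=
  forall x y t, I01 x -> I01 y -> I01 t ->
    f ((1 - t) * x + t * y) <= (1 - t) * f x + t * f y.

Definition inCc (f : R -> R) : Prop := inC f /\ convex01 f.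

Definition inD (f : R -> R) : Prop :=
  inC f /\ (forall x y, 0 <= x -> x < y -> y <= 1 -> f y < f x).

(* derivative of f at x relative to [0,1] (at x = 1 this is the left
   derivative; at interior points the usual derivative) *)
Definition deriv01 (f : R -> R) (x l : R) : Prop :=
  forall eps, 0 < eps -> exists delta, 0 < delta /\
    forall y, I01 y -> y <> x -> Rabs (y - x) < delta ->
      Rabs ((f y - f x) / (y - x) - l) < eps.

Definition C1_on_0_1 (f fp : R -> R) : Prop :=
  (forall x, 0 < x <= 1 -> deriv01 f x (fp x)) /\
  (forall x, 0 < x <= 1 -> forall eps, 0 < eps -> exists delta, 0 < delta /\
     forall y, 0 < y <= 1 -> Rabs (y - x) < delta -> Rabs (fp y - fp x) < eps).

Definition inD' (f : R -> R) : Prop := inD f /\ exists fp, C1_on_0_1 f fp.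

Definition inDsharp (f : R -> R) : Prop :=
  inD f /\ exists fp, C1_on_0_1 f fp /\ fp 1 = 0 /\
    exists L, L <= 0 /\
      forall eps, 0 < eps -> exists delta, 0 < delta /\
        forall y, 0 < y <= 1 -> y < delta -> Rabs (fp y - L) < eps.

Definition inDsharpc (f : R -> R) : Prop := inDsharp f /\ inCc f.

Definition stride (g : R -> R) : Rbar :=
  Lub_Rbar (fun a => 0 <= a /\ forall x, I01 x -> a - x <= a * g x).

Definition gstar (g : R -> R) (y : R) : R :=
  real (Lub_Rbar (fun x => I01 x /\ y <= g x)).

Definition T (f : R -> R) : R -> R :=
  fun x => RInt (gstar f) x 1 / integ f.

Definition Titer (n : nat) (f : R -> R) : R -> R := Nat.iter n T f.

Definition distinf (f g : R -> R) : R :=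
  real (Lub_Rbar (fun r => exists x, I01 x /\ r = Rabs (f x - g x))).

Definition dist1 (f g : R -> R) : R := RInt (fun x => Rabs (f x - g x)) 0 1.

Definition inK (g : R -> R) : Prop :=
  inCc g /\ Rbar_le (Finite (1/5)) (stride g) /\ 1/5 <= integ g.

Definition is_metric (d : (R -> R) -> (R -> R) -> R) : Prop := d = distinf \/ d = dist1.

(* Main.v *)
(* For g in K put h := g^*. The layer-cake formula
     int_x^1 h = int_0^1 max (g u - x, 0) du
   gives int h = int g and shows that T is Lipschitz from d_1 to d_oo on K.
   Membership in K amounts to g >= 1 - 5 x and int g >= 1/5 for a convex g running
   from 1 to 0. Since h is decreasing with values in [0, 1], T g is convex and
   T g >= 1 - x / int g. Since h is convex, the bound g >= 1 - x / a with a <= 1/5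
   forces int T g = (int y h) / (int h) >= (51/50) a. Hence K is stable under T, and
   the lower bounds for stride and integral grow geometrically along the iterates of
   T until they reach 1/5. Functions in K are 5-Lipschitz, so that d_oo^2 is bounded
   by a multiple of d_1, and an Arzela-Ascoli argument gives compactness, hence
   completeness. *)

Require Import Defs.
From Stdlib Require Import Reals Lra Lia ClassicalEpsilon.
From Coquelicot Require Import Coquelicot.
Open Scope R_scope.

(** The bounds on stride and integral feed each other with a delay: the stride of T g is at least
    the integral of g, while the integral of T g exceeds the stride bound for g by a factor. One
    application thus improves the integral, and a second one hands the gain to the stride, so growth
    is counted over two applications of T. The factor 51/50 is a convenient number above 1; the
    moment estimate behind it tolerates about 1.03 at a = 1/5.

    Functions of E may jump, and so may their generalised inverses, so the primitives involved need
    not be differentiable. The layer-cake formula and the formula for the integral of T g both rest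
    on one substitute for differentiation: if the increments of F over [s, t] are at most (t - s)
    (phi s - phi t), then F 1 = F 0. Monotone integrands give such bounds by comparison with their
    endpoint values. *)

Definition dec01 (f : R -> R) : Prop :=
  forall x y, 0 <= x -> x <= y -> y <= 1 -> f y <= f x.

Definition unit_dec (f : R -> R) : Prop :=
  dec01 f /\ forall x, I01 x -> 0 <= f x <= 1.

(** * Integrals of monotone functions *)

(** For z >= 0 this is min (floor z, n), written as a sum of indicators of k <= z. Composed with a
    decreasing function, each summand becomes the indicator of an initial interval, hence visibly
    integrable. *)
Fixpoint stairs (n : nat) (z : R) : R :=
  match n with
  | O => 0
  | S m => stairs m z + (if Rle_dec (INR (S m)) z then 1 else 0)
  end.

Lemma stairs_approx (n : nat) (z : R) :
  0 <= z -> stairs n z <= z /\ stairs n z <= INR n /\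
            (z <= stairs n z + 1 \/ stairs n z = INR n).
Proof.
  intros Hz. induction n as [|n IH].
  - simpl. lra.
  - cbn [stairs]. rewrite S_INR. destruct (Rle_dec (INR n + 1) z); lra.
Qed.

Lemma level_cut (f : R -> R) (v : R) :
  dec01 f ->
  exists c, I01 c /\ (forall x, 0 < x < c -> v <= f x) /\
            (forall x, c < x < 1 -> f x < v).
Proof.
  intros Hf.
  (* Adjoining 0 keeps the set nonempty when f stays below v. *)
  destruct (completeness (fun x => I01 x /\ (x = 0 \/ v <= f x))) as [c [Hub Hlub]].
  - exists 1. intros x [[_ H] _]. exact H.
  - exists 0. unfold I01. split; [lra | now left].
  - assert (0 <= c) by (apply Hub; unfold I01; split; [lra | now left]).
    assert (c <= 1) by (apply Hlub; intros x [[_ K] _]; exact K).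
    exists c. split; [unfold I01; lra|]. split; intros x Hx.
    + apply Rnot_lt_le. intro K. assert (c <= x); [|lra]. apply Hlub.
      intros y [Hy [->|L]]; [lra|]. apply Rnot_lt_le. intro M.
      destruct Hy. pose proof (Hf x y). lra.
    + apply Rnot_le_lt. intro K. assert (x <= c); [|lra]. apply Hub.
      split; [unfold I01; lra | now right].
Qed.

Lemma ex_RInt_stairs (f : R -> R) (n : nat) (c : R) :
  0 <= c -> dec01 f -> ex_RInt (fun x => stairs n (c * f x)) 0 1.
Proof.
  intros Hc Hf. induction n as [|n IH]; cbn [stairs].
  - apply ex_RInt_const.
  - apply (ex_RInt_plus (V := R_NormedModule)); [exact IH|].
    destruct (level_cut (fun x => c * f x) (INR (S n))) as (p & Hp & H1 & H2).
    { intros x y ? ? ?. apply Rmult_le_compat_l; auto. }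
    destruct Hp. apply ex_RInt_Chasles with p.
    + apply ex_RInt_ext with (fun _ => 1); [|apply ex_RInt_const].
      intros x. rewrite Rmin_left, Rmax_right by lra. intros Hx.
      destruct (Rle_dec _ _) as [_|K]; [reflexivity|]. now destruct K; apply H1.
    + apply ex_RInt_ext with (fun _ => 0); [|apply ex_RInt_const].
      intros x. rewrite Rmin_left, Rmax_right by lra. intros Hx.
      destruct (Rle_dec _ _) as [K|_]; [|reflexivity].
      apply H2 in Hx. lra.
Qed.

(** A decreasing function with values in [0, 1] is the uniform limit of the step functions obtained
    by rounding its values down to multiples of 1/(n+1). *)
Lemma ex_RInt_unit_dec (f : R -> R) : unit_dec f -> ex_RInt f 0 1.
Proof.
  (* Uniform convergence is required on all of R, so f is first frozen outside [0, 1]. *)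
  intros [Hd Hb]. pose (F := fun x => f (Rmax 0 (Rmin x 1))).
  assert (HF : forall x, I01 x -> F x = f x).
  { intros x [? ?]. unfold F. now rewrite Rmin_left, Rmax_right by lra. }
  apply ex_RInt_ext with F.
  { intros x. rewrite Rmin_left, Rmax_right by lra. intros. apply HF. unfold I01. lra. }
  assert (HFd : dec01 F).
  { intros x y ? ? ?. rewrite !HF by (unfold I01; lra). now apply Hd. }
  assert (HFb : forall x, 0 <= F x <= 1).
  { intros x. apply Hb. split; [apply Rmax_l|]. apply Rmax_lub; [lra | apply Rmin_r]. }
  pose (u := fun (n : nat) (x : R) => / INR (S n) * stairs (S n) (INR (S n) * F x)).
  destruct (filterlim_RInt (V := R_CompleteNormedModule) u 0 1 eventually _ F
              (fun n => RInt (u n) 0 1)) as (If & _ & HI).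
  - intros n. apply RInt_correct. apply (ex_RInt_scal (V := R_NormedModule)).
    apply ex_RInt_stairs; [apply pos_INR | exact HFd].
  - apply filterlim_locally. intros eps.
    destruct (archimed_cor1 eps (cond_pos eps)) as (N & HN & HN0).
    exists N. intros n Hn t.
    change (Rabs (u n t - F t) < eps). unfold u.
    set (m := INR (S n)).
    assert (Hm : INR N <= m) by (apply le_INR; lia).
    assert (HNp : 0 < INR N) by now apply lt_0_INR.
    assert (Him : / m <= / INR N) by (apply Rinv_le_contravar; lra).
    destruct (HFb t) as [Ht0 Ht1].
    destruct (stairs_approx (S n) (m * F t)) as (A & B & C); [nra|].
    fold m in B, C. set (s := stairs (S n) (m * F t)) in *.
    replace (/ m * s - F t) with (/ m * (s - m * F t)) by (field; lra).
    assert (0 < / m) by (apply Rinv_0_lt_compat; lra).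
    apply Rabs_def1; [nra|].
    assert (- 1 <= s - m * F t) by (destruct C; nra). nra.
  - now exists If.
Qed.

Lemma ex_RInt_sub (f : R -> R) (a b : R) :
  ex_RInt f 0 1 -> 0 <= a -> a <= b -> b <= 1 -> ex_RInt f a b.
Proof.
  intros Hf ? ? ?. apply (ex_RInt_Chasles_2 (V := R_CompleteNormedModule) f 0); [lra|].
  apply (ex_RInt_Chasles_1 (V := R_CompleteNormedModule) f 0 b 1); [lra | exact Hf].
Qed.

Lemma RInt_split (f : R -> R) (a b c : R) :
  ex_RInt f 0 1 -> 0 <= a -> a <= b -> b <= c -> c <= 1 ->
  RInt f a c = RInt f a b + RInt f b c.
Proof.
  intros Hf ? ? ? ?. symmetry.
  apply (RInt_Chasles (V := R_CompleteNormedModule)); apply ex_RInt_sub; auto; lra.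
Qed.

Lemma RInt_cst (a b c : R) : RInt (fun _ => c) a b = (b - a) * c.
Proof. apply (RInt_const (V := R_CompleteNormedModule)). Qed.

Lemma RInt_sub (f g : R -> R) (a b : R) :
  ex_RInt f a b -> ex_RInt g a b ->
  RInt (fun x => f x - g x) a b = RInt f a b - RInt g a b.
Proof. apply (RInt_minus (V := R_CompleteNormedModule)). Qed.

Lemma ex_RInt_Rminus (f g : R -> R) (a b : R) :
  ex_RInt f a b -> ex_RInt g a b -> ex_RInt (fun x => f x - g x) a b.
Proof. apply (ex_RInt_minus (V := R_NormedModule)). Qed.

Lemma RInt_lower (f : R -> R) (a b m : R) :
  ex_RInt f 0 1 -> 0 <= a -> a <= b -> b <= 1 ->
  (forall x, a < x < b -> m <= f x) -> (b - a) * m <= RInt f a b.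
Proof.
  intros Hf ? ? ? H. rewrite <- RInt_cst.
  apply RInt_le; auto; [apply ex_RInt_const | apply ex_RInt_sub; auto].
Qed.

Lemma RInt_upper (f : R -> R) (a b m : R) :
  ex_RInt f 0 1 -> 0 <= a -> a <= b -> b <= 1 ->
  (forall x, a < x < b -> f x <= m) -> RInt f a b <= (b - a) * m.
Proof.
  intros Hf ? ? ? H. rewrite <- RInt_cst.
  apply RInt_le; auto; [apply ex_RInt_sub; auto | apply ex_RInt_const].
Qed.

(* Summing the hypothesis over the partition of [0,1] into n equal intervals
   gives |F 1 - F 0| <= (phi 0 - phi 1) / n. *)
Lemma increments_const (F phi : R -> R) :
  (forall s t, 0 <= s -> s <= t -> t <= 1 ->
     Rabs (F t - F s) <= (t - s) * (phi s - phi t)) ->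
  F 1 = F 0.
Proof.
  intros H.
  assert (K : forall n, (0 < n)%nat -> Rabs (F 1 - F 0) <= / INR n * (phi 0 - phi 1)).
  { intros n Hn. assert (Hp : 0 < INR n) by now apply lt_0_INR.
    assert (L : forall k, (k <= n)%nat ->
      Rabs (F (INR k / INR n) - F 0) <= / INR n * (phi 0 - phi (INR k / INR n))).
    { induction k as [|k IH]; intros Hk.
      - replace (INR 0 / INR n) with 0 by (simpl; field; lra).
        rewrite Rminus_diag, Rabs_R0. lra.
      - specialize (IH ltac:(lia)).
        assert (Hk' : INR (S k) <= INR n) by (apply le_INR; lia).
        assert (E : INR (S k) / INR n - INR k / INR n = / INR n)
          by (rewrite S_INR; field; lra).
        assert (0 < / INR n) by now apply Rinv_0_lt_compat.
        specialize (H (INR k / INR n) (INR (S k) / INR n)). rewrite E in H.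
        assert (0 <= INR k / INR n)
          by (apply Rmult_le_pos; [apply pos_INR | lra]).
        assert (INR (S k) / INR n <= 1)
          by (apply Rmult_le_reg_r with (INR n); [lra|]; unfold Rdiv;
              rewrite Rmult_assoc, Rinv_l by lra; lra).
        specialize (H ltac:(assumption) ltac:(lra) ltac:(assumption)).
        replace (F (INR (S k) / INR n) - F 0) with
          ((F (INR (S k) / INR n) - F (INR k / INR n)) + (F (INR k / INR n) - F 0)) by ring.
        eapply Rle_trans; [apply Rabs_triang|]. lra. }
    specialize (L n (le_n n)).
    now replace (INR n / INR n) with 1 in L by (field; lra). }
  destruct (Req_dec (F 1) (F 0)) as [E|E]; [exact E|exfalso].
  assert (Ha : 0 < Rabs (F 1 - F 0)) by (apply Rabs_pos_lt; lra).
  set (a := Rabs (F 1 - F 0)) in *. set (D := phi 0 - phi 1) in *.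
  assert (HD : 0 < D) by (pose proof (K 1%nat ltac:(lia)) as K1; simpl in K1;
                          rewrite Rinv_1 in K1; lra).
  destruct (archimed_cor1 (a / D)) as (N & HN & HN0).
  { now apply Rdiv_lt_0_compat. }
  specialize (K N HN0).
  apply (Rmult_lt_compat_r D) in HN; [|lra].
  unfold Rdiv in HN. rewrite Rmult_assoc, Rinv_l in HN by lra. lra.
Qed.

(** * The generalised inverse and the operator T *)

Lemma inE_unit_dec (f : R -> R) : inE f -> unit_dec f.
Proof.
  intros (Hd & Hp & H0 & _). split; [exact Hd|]. intros x Hx.
  split; [now apply Hp|]. rewrite <- H0. destruct Hx. apply Hd; lra.
Qed.

Section Gstar.

Variables (f : R -> R) (y : R).
Hypotheses (f0 : f 0 = 1) (y1 : y <= 1).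

Let E := fun x => I01 x /\ y <= f x.

(** For y <= 1 the set contains 0 and lies in [0, 1], so its supremum is finite and [real] does not
    fall back on its default value. *)
Lemma gstar_is_lub : is_lub_Rbar E (Finite (gstar f y)).
Proof.
  pose proof (Lub_Rbar_correct E) as [Hub Hlub].
  assert (H0 : Rbar_le 0 (Lub_Rbar E)).
  { apply Hub. split; unfold I01; lra. }
  assert (H1 : Rbar_le (Lub_Rbar E) 1).
  { apply Hlub. intros x [[_ Hx] _]. exact Hx. }
  unfold gstar. fold E.
  destruct (Lub_Rbar E) as [r| |]; simpl in *; try tauto. now split.
Qed.

Lemma gstar_ge (x : R) : I01 x -> y <= f x -> x <= gstar f y.
Proof. intros. now apply (proj1 gstar_is_lub x). Qed.

Lemma gstar_le (b : R) :
  (forall x, I01 x -> y <= f x -> x <= b) -> gstar f y <= b.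
Proof. intros H. apply (proj2 gstar_is_lub b). intros x [? ?]. now apply H. Qed.

End Gstar.

Lemma gstar_unit_dec (f : R -> R) : f 0 = 1 -> unit_dec (gstar f).
Proof.
  intros f0. split.
  - intros x y ? ? ?. apply gstar_le; auto. intros. apply gstar_ge; auto; lra.
  - intros x [? ?]. split.
    + apply gstar_ge; auto; unfold I01; lra.
    + apply gstar_le; auto. now intros z [].
Qed.

Lemma unit_dec_pos_part (f : R -> R) (x : R) :
  0 <= x -> unit_dec f -> unit_dec (fun u => Rmax (f u - x) 0).
Proof.
  intros Hx [Hd Hb]. split.
  - intros a b ? ? ?. apply Rle_max_compat_r. specialize (Hd a b). lra.
  - intros a Ha. specialize (Hb a Ha). split; [apply Rmax_r|]. apply Rmax_lub; lra.
Qed.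

Lemma unit_dec_Rmin (f : R -> R) (t : R) :
  0 <= t -> unit_dec f -> unit_dec (fun y => Rmin (f y) t).
Proof.
  intros Ht [Hd Hb]. split.
  - intros a b ? ? ?. apply Rle_min_compat_r. now apply Hd.
  - intros a Ha. specialize (Hb a Ha). split; [apply Rmin_glb; lra|].
    eapply Rle_trans; [apply Rmin_l | lra].
Qed.

(* Both sides measure the region {(u, y) : x <= y <= f u}; cutting it off at
   abscissa u = t, the increments of both areas over [s, t] lie between
   (t - s) (f t - x)^+ and (t - s) (f s - x)^+. *)
Lemma layer_cake (f : R -> R) (x : R) :
  unit_dec f -> f 0 = 1 -> I01 x ->
  RInt (gstar f) x 1 = RInt (fun u => Rmax (f u - x) 0) 0 1.
Proof.
  intros Hf f0 [Hx0 Hx1].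
  pose (phi := fun u => Rmax (f u - x) 0).
  assert (Hphi : unit_dec phi) by now apply unit_dec_pos_part.
  pose proof (gstar_unit_dec f f0) as Hg.
  pose proof (ex_RInt_unit_dec _ Hphi) as Iphi.
  pose (B := fun t => RInt (fun y => Rmin (gstar f y) t) x 1).
  assert (EB1 : B 1 = RInt (gstar f) x 1).
  { apply RInt_ext. intros y. rewrite Rmin_left, Rmax_right by lra. intros Hy.
    apply Rmin_left. apply Hg. unfold I01. lra. }
  assert (EB0 : B 0 = 0).
  { unfold B. rewrite (RInt_ext _ (fun _ => 0)).
    - rewrite RInt_cst. apply Rmult_0_r.
    - intros y. rewrite Rmin_left, Rmax_right by lra. intros Hy.
      apply Rmin_right. apply Hg. unfold I01. lra. }
  assert (E : RInt phi 0 1 - B 1 = RInt phi 0 0 - B 0).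
  { apply (increments_const (fun t => RInt phi 0 t - B t) phi).
    intros s t Hs Hst Ht.
    rewrite (RInt_split phi 0 s t) by (auto; lra).
    pose proof (ex_RInt_unit_dec _ (unit_dec_Rmin _ t ltac:(lra) Hg)) as It.
    pose proof (ex_RInt_unit_dec _ (unit_dec_Rmin _ s ltac:(lra) Hg)) as Is.
    assert (EB : B t - B s = RInt (fun y => Rmin (gstar f y) t - Rmin (gstar f y) s) x 1).
    { unfold B. rewrite RInt_sub; [reflexivity| |]; apply ex_RInt_sub; auto; lra. }
    pose proof (ex_RInt_Rminus _ _ _ _ It Is) as Id.
    set (d := fun y => Rmin (gstar f y) t - Rmin (gstar f y) s) in *.
    assert (Hd : forall y, 0 <= d y <= t - s).
    { intros y. unfold d, Rmin. destruct (Rle_dec _ t), (Rle_dec _ s); lra. }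
    assert (L1 : (t - s) * phi t <= RInt phi s t).
    { apply RInt_lower; auto. intros u Hu. apply (proj1 Hphi); lra. }
    assert (U1 : RInt phi s t <= (t - s) * phi s).
    { apply RInt_upper; auto; try lra. intros u Hu. apply (proj1 Hphi); lra. }
    (* [x + phi w] is max (x, f w), the height where the vertical line at w leaves the region: below
       it [gstar f y] is at least w, above it at most w. Hence d equals t - s below the height at t
       and 0 above the height at s. *)
    assert (Hcut : forall w, I01 w -> x <= x + phi w <= 1).
    { intros w Hw. unfold phi. pose proof (proj2 Hf w Hw).
      unfold Rmax. destruct (Rle_dec _ _); lra. }
    assert (L2 : (t - s) * phi t <= B t - B s).
    { destruct (Hcut t ltac:(unfold I01; lra)) as [C1 C2].
      rewrite EB, (RInt_split d x (x + phi t) 1) by (auto; lra).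
      assert ((x + phi t - x) * (t - s) <= RInt d x (x + phi t)).
      { apply RInt_lower; auto. intros y [Hy1 Hy2].
        assert (t <= gstar f y).
        { apply gstar_ge; auto; [lra | unfold I01; lra|].
          unfold phi, Rmax in Hy2. destruct (Rle_dec _ _); lra. }
        unfold d. rewrite !Rmin_right; lra. }
      assert ((1 - (x + phi t)) * 0 <= RInt d (x + phi t) 1).
      { apply RInt_lower; auto; try lra. intros y _. apply Hd. }
      lra. }
    assert (U2 : B t - B s <= (t - s) * phi s).
    { destruct (Hcut s ltac:(unfold I01; lra)) as [C1 C2].
      rewrite EB, (RInt_split d x (x + phi s) 1) by (auto; lra).
      assert (RInt d x (x + phi s) <= (x + phi s - x) * (t - s)).
      { apply RInt_upper; auto. intros y _. apply Hd. }
      assert (RInt d (x + phi s) 1 <= (1 - (x + phi s)) * 0).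
      { apply RInt_upper; auto; try lra. intros y [Hy1 Hy2].
        assert (gstar f y <= s).
        { apply gstar_le; auto; [lra|]. intros z [Hz0 Hz1] Hz.
          apply Rnot_lt_le. intro K. pose proof (proj1 Hf s z Hs ltac:(lra) Hz1).
          unfold phi, Rmax in Hy1. destruct (Rle_dec _ _); lra. }
        unfold d. rewrite !Rmin_left; lra. }
      lra. }
    apply Rabs_le. lra. }
  rewrite EB1, EB0, RInt_point in E. change (zero : R) with 0 in E.
  unfold phi in E. lra.
Qed.

Lemma integ_gstar (f : R -> R) :
  unit_dec f -> f 0 = 1 -> RInt (gstar f) 0 1 = integ f.
Proof.
  intros Hf f0. rewrite layer_cake by (auto; unfold I01; lra).
  apply RInt_ext. intros u. rewrite Rmin_left, Rmax_right by lra. intros Hu.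
  rewrite Rmax_left; [lra|]. pose proof (proj2 Hf u ltac:(unfold I01; lra)). lra.
Qed.

(** * Tail integrals of decreasing functions *)

Definition tail (h : R -> R) (x : R) : R := RInt h x 1.

Section Tail.

Variable h : R -> R.
Hypothesis Hh : unit_dec h.

(** The mean slope of the tail over [x, y] lies between - h x and - h y. Monotonicity, the Lipschitz
    bound, convexity and later the derivative of T g are all read off from this. *)
Lemma tail_diff (x y : R) :
  0 <= x -> x <= y -> y <= 1 ->
  (y - x) * h y <= tail h x - tail h y <= (y - x) * h x.
Proof.
  intros Hx Hxy Hy. unfold tail.
  pose proof (ex_RInt_unit_dec h Hh) as Ih.
  rewrite (RInt_split h x y 1) by (auto; lra).
  assert ((y - x) * h y <= RInt h x y).
  { apply RInt_lower; auto. intros u Hu. apply (proj1 Hh); lra. }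
  assert (RInt h x y <= (y - x) * h x).
  { apply RInt_upper; auto. intros u Hu. apply (proj1 Hh); lra. }
  lra.
Qed.

Lemma tail_1 : tail h 1 = 0.
Proof. apply (RInt_point (V := R_CompleteNormedModule)). Qed.

Lemma tail_unit_dec : unit_dec (tail h).
Proof.
  assert (D : dec01 (tail h)).
  { intros x y ? ? ?. pose proof (tail_diff x y).
    pose proof (proj2 Hh y ltac:(unfold I01; lra)). nra. }
  split; [exact D|]. intros x [? ?].
  pose proof (D x 1). pose proof (tail_diff x 1). pose proof tail_1.
  pose proof (proj2 Hh x ltac:(unfold I01; lra)). nra.
Qed.

Lemma tail_lip (x y : R) :
  I01 x -> I01 y -> Rabs (tail h y - tail h x) <= Rabs (y - x).
Proof.
  assert (K : forall a b, I01 a -> I01 b -> a <= b ->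
            Rabs (tail h b - tail h a) <= Rabs (b - a)).
  { intros a b [? ?] [? ?] ?. pose proof (tail_diff a b).
    pose proof (proj2 Hh a ltac:(unfold I01; lra)).
    pose proof (proj2 Hh b ltac:(unfold I01; lra)).
    rewrite (Rabs_right (b - a)) by lra. apply Rabs_le. nra. }
  intros Hx Hy. destruct (Rle_dec x y); [now apply K|].
  rewrite Rabs_minus_sym, (Rabs_minus_sym y). apply K; auto; lra.
Qed.

Lemma tail_convex : convex01 (tail h).
Proof.
  assert (K : forall x y t, I01 x -> I01 y -> I01 t -> x <= y ->
    tail h ((1 - t) * x + t * y) <= (1 - t) * tail h x + t * tail h y).
  { intros x y t [? ?] [? ?] [? ?] Hxy.
    set (p := (1 - t) * x + t * y).
    assert (p - x = t * (y - x)) by (unfold p; ring).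
    assert (y - p = (1 - t) * (y - x)) by (unfold p; ring).
    assert (0 <= t * (y - x)) by nra.
    assert (0 <= (1 - t) * (y - x)) by nra.
    (* With weights 1 - t on [x, p] and t on [p, y], both bounds produce the same quantity t (1 - t)
       (y - x) h p, which cancels. *)
    pose proof (proj1 (tail_diff x p ltac:(lra) ltac:(lra) ltac:(lra))) as A.
    pose proof (proj2 (tail_diff p y ltac:(lra) ltac:(lra) ltac:(lra))) as B.
    replace (p - x) with (t * (y - x)) in A.
    replace (y - p) with ((1 - t) * (y - x)) in B.
    apply (Rmult_le_compat_l (1 - t)) in A; [|lra].
    apply (Rmult_le_compat_l t) in B; [|lra].
    nra. }
  intros x y t Hx Hy Ht. destruct (Rle_dec x y); [now apply K|].
  destruct Ht. pose proof (K y x (1 - t) Hy Hx ltac:(unfold I01; lra) ltac:(lra)) as L.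
  replace (1 - (1 - t)) with t in L by ring.
  rewrite (Rplus_comm ((1 - t) * x)). lra.
Qed.

End Tail.

(** * The operator T on E *)

Lemma T_tail (f : R -> R) (x : R) : T f x = tail (gstar f) x / integ f.
Proof. reflexivity. Qed.

Lemma integ_le_1 (f : R -> R) : unit_dec f -> integ f <= 1.
Proof.
  intros Hf. unfold integ. pose proof (ex_RInt_unit_dec f Hf).
  assert (RInt f 0 1 <= (1 - 0) * 1); [|lra].
  apply RInt_upper; auto; try lra. intros x Hx. apply Hf. unfold I01. lra.
Qed.

Lemma T_0 (f : R -> R) : inE f -> T f 0 = 1.
Proof.
  intros Hf. pose proof (inE_unit_dec f Hf) as Hu. destruct Hf as (_ & _ & f0 & HI).
  unfold T. rewrite integ_gstar by auto. field. lra.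
Qed.

Lemma T_1 (f : R -> R) : T f 1 = 0.
Proof. rewrite T_tail, tail_1. unfold Rdiv. ring. Qed.

(** Since f^* <= 1, the function T f starts at 1 and falls with slope at most 1 / int f. This is the
    source of every stride bound below. *)
Lemma T_lower (f : R -> R) (x : R) :
  inE f -> I01 x -> 1 - x / integ f <= T f x.
Proof.
  intros Hf [? ?]. rewrite <- (T_0 f Hf), !T_tail.
  destruct Hf as (_ & _ & f0 & HI). pose proof (gstar_unit_dec f f0) as Hg.
  pose proof (tail_diff _ Hg 0 x) as D.
  pose proof (proj2 Hg 0 ltac:(unfold I01; lra)).
  unfold Rdiv. rewrite <- Rmult_minus_distr_r.
  apply Rmult_le_compat_r; [left; now apply Rinv_0_lt_compat|]. nra.
Qed.

Lemma T_unit_dec (f : R -> R) : inE f -> unit_dec (T f).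
Proof.
  intros Hf. pose proof (T_0 f Hf) as H0.
  destruct Hf as (_ & _ & f0 & HI). pose proof (gstar_unit_dec f f0) as Hg.
  pose proof (tail_unit_dec _ Hg) as Ht.
  assert (0 < / integ f) by now apply Rinv_0_lt_compat.
  assert (D : dec01 (T f)).
  { intros x y ? ? ?. rewrite !T_tail. apply Rmult_le_compat_r; [lra|]. now apply Ht. }
  split; [exact D|]. intros x [? ?]. rewrite <- H0, <- (T_1 f) at 1. split; apply D; lra.
Qed.

Lemma T_integ_pos (f : R -> R) : inE f -> 0 < integ (T f).
Proof.
  intros Hf. pose proof (T_unit_dec f Hf) as Hu.
  pose proof (integ_le_1 f (inE_unit_dec f Hf)).
  assert (HI : 0 < integ f) by apply Hf.
  pose proof (ex_RInt_unit_dec _ Hu) as Ii.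
  unfold integ at 1. rewrite (RInt_split _ 0 (integ f / 2) 1) by (auto; lra).
  (* By [T_lower], T f is at least 1/2 up to half the integral of f. *)
  assert ((integ f / 2 - 0) * (1 / 2) <= RInt (T f) 0 (integ f / 2)).
  { apply RInt_lower; auto; try lra. intros x Hx.
    eapply Rle_trans; [|apply T_lower; [exact Hf | unfold I01; lra]].
    assert (x / integ f <= 1 / 2); [|lra].
    apply Rmult_le_reg_r with (integ f); [lra|]. unfold Rdiv.
    rewrite Rmult_assoc, Rinv_l by lra. lra. }
  assert ((1 - integ f / 2) * 0 <= RInt (T f) (integ f / 2) 1).
  { apply RInt_lower; auto; try lra. intros x Hx. apply Hu. unfold I01. lra. }
  lra.
Qed.

Lemma T_inCc (f : R -> R) : inE f -> inCc (T f).
Proof.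
  intros Hf. pose proof (T_unit_dec f Hf) as [Hd Hb]. pose proof (T_0 f Hf) as H0.
  pose proof (T_integ_pos f Hf) as HIT.
  destruct Hf as (_ & _ & f0 & HI). pose proof (gstar_unit_dec f f0) as Hg.
  assert (Hi : 0 < / integ f) by now apply Rinv_0_lt_compat.
  repeat split; auto; try apply T_1.
  - intros x Hx. now apply Hb.
  - intros x Hx eps He. exists (eps * integ f). split; [nra|].
    intros y Hy Hxy. rewrite !T_tail. unfold Rdiv.
    rewrite <- Rmult_minus_distr_r, Rabs_mult, (Rabs_right (/ integ f)) by lra.
    pose proof (tail_lip _ Hg x y Hx Hy).
    apply Rmult_lt_reg_r with (integ f); [lra|].
    rewrite Rmult_assoc, Rinv_l by lra. lra.
  - intros x y t Hx Hy Ht. rewrite !T_tail.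
    pose proof (tail_convex _ Hg x y t Hx Hy Ht) as C.
    apply (Rmult_le_compat_r (/ integ f)) in C; [|lra]. unfold Rdiv. lra.
Qed.

(** * Inverses of convex functions *)

(** The condition that a is admissible in the supremum defining the stride: for a > 0, g lies above
    the line through (0, 1) and (a, 0). *)
Definition above (a : R) (g : R -> R) : Prop :=
  forall x, I01 x -> a * (1 - g x) <= x.

Section Inverse.

Variable g : R -> R.
Hypothesis Hg : inCc g.

Let g0 : g 0 = 1.
Proof. apply Hg. Qed.

Let g1 : g 1 = 0.
Proof. apply Hg. Qed.

Let g_unit_dec : unit_dec g.
Proof. apply inE_unit_dec, Hg. Qed.

Lemma inCc_le_chord (x : R) : I01 x -> g x <= 1 - x.
Proof.
  intros Hx. pose proof (proj2 Hg 0 1 x ltac:(unfold I01; lra) ltac:(unfold I01; lra) Hx) as C.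
  rewrite g0, g1 in C. replace ((1 - x) * 0 + x * 1) with x in C by ring. lra.
Qed.

(** The chord from (x, g x) to (1, 0) descends strictly. So g can be constant only where it
    vanishes, and level 0 is the only one at which its inverse may jump. *)
Lemma inCc_strict (x z : R) : 0 <= x -> x < z -> z <= 1 -> 0 < g x -> g z < g x.
Proof.
  intros Hx Hxz Hz Hp. pose (t := (z - x) / (1 - x)).
  assert (Et : t * (1 - x) = z - x) by (unfold t; field; lra).
  assert (Ht : 0 < t) by (apply Rdiv_lt_0_compat; lra).
  assert (t <= 1) by nra.
  pose proof (proj2 Hg x 1 t ltac:(unfold I01; lra) ltac:(unfold I01; lra)
                ltac:(unfold I01; lra)) as C.
  replace ((1 - t) * x + t * 1) with z in C by lra.
  rewrite g1 in C. nra.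
Qed.

Lemma gstar_in_I01 (y : R) : I01 y -> I01 (gstar g y).
Proof. apply gstar_unit_dec, g0. Qed.

Lemma gstar_right_inv (y : R) : I01 y -> g (gstar g y) = y.
Proof.
  intros Hy. pose proof (gstar_in_I01 y Hy) as Hh.
  set (h := gstar g y) in *.
  assert (Hc : cont01 g) by apply Hg.
  apply Rle_antisym; apply Rnot_lt_le; intro K.
  - destruct (Hc h Hh (g h - y)) as (d & Hd & H); [lra|].
    destruct Hy, Hh. assert (h < 1).
    { destruct (Req_dec h 1) as [E|E]; [|lra]. rewrite E, g1 in K. lra. }
    pose (x := Rmin 1 (h + d / 2)).
    assert (Hx : h < x <= 1 /\ x <= h + d / 2).
    { unfold x, Rmin. destruct (Rle_dec _ _); lra. }
    assert (A : Rabs (g x - g h) < g h - y).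
    { apply H; [unfold I01; lra|]. rewrite Rabs_right; lra. }
    apply Rabs_def2 in A.
    assert (x <= h) by (apply gstar_ge; auto; unfold I01; lra). lra.
  - destruct (Hc h Hh (y - g h)) as (d & Hd & H); [lra|].
    assert (h <= h - d); [|lra]. destruct Hy.
    apply gstar_le; auto. intros x Hx Hyx. apply Rnot_lt_le. intro L.
    assert (x <= h) by now apply gstar_ge.
    assert (A : Rabs (g x - g h) < y - g h).
    { apply H; auto. apply Rabs_def1; lra. }
    apply Rabs_def2 in A. lra.
Qed.

Lemma gstar_le_of_le (x y : R) :
  0 <= x -> 0 < y -> y <= 1 -> g x <= y -> gstar g y <= x.
Proof.
  intros Hx Hy0 Hy1 H. apply gstar_le; auto. intros z [? ?] Hz.
  apply Rnot_lt_le. intro K.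
  pose proof (inCc_strict x z Hx K ltac:(lra)).
  pose proof (proj1 g_unit_dec x z). lra.
Qed.

Lemma gstar_at_0 : gstar g 0 = 1.
Proof.
  apply Rle_antisym; [apply gstar_in_I01; unfold I01; lra|].
  apply gstar_ge; auto; unfold I01; lra.
Qed.

(** Convexity of g at the two inverse values p and q bounds g at their mean by the mean of the
    levels; the decreasing inverse reverses this into the claim. *)
Lemma gstar_convex : convex01 (gstar g).
Proof.
  intros y z t Hy Hz Ht.
  pose proof (gstar_right_inv y Hy) as Ey. pose proof (gstar_right_inv z Hz) as Ez.
  pose proof (gstar_in_I01 y Hy) as Iy. pose proof (gstar_in_I01 z Hz) as Iz.
  pose proof (proj2 Hg _ _ t Iy Iz Ht) as C. rewrite Ey, Ez in C.
  set (p := gstar g y) in *. set (q := gstar g z) in *.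
  destruct Hy, Hz, Ht, Iy, Iz.
  assert (0 <= (1 - t) * y + t * z <= 1) by nra.
  (* Level 0 is separate: there g x <= y does not bound the inverse by x, since g may vanish before
     1 while [gstar g 0] is 1. Every level of nonzero weight is then 0 as well. *)
  destruct (Req_dec ((1 - t) * y + t * z) 0) as [E|E].
  - rewrite E, gstar_at_0.
    assert (A : (1 - t) * y = 0) by nra. assert (B : t * z = 0) by nra.
    assert (P1 : y = 0 -> p = 1) by (intros ->; apply gstar_at_0).
    assert (Q1 : z = 0 -> q = 1) by (intros ->; apply gstar_at_0).
    destruct (Rmult_integral _ _ A) as [A1|A1]; destruct (Rmult_integral _ _ B) as [B1|B1].
    + lra.
    + rewrite (Q1 B1). nra.
    + rewrite (P1 A1), B1. lra.
    + rewrite (P1 A1), (Q1 B1). lra.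
  - apply gstar_le_of_le; try lra. nra.
Qed.

Lemma gstar_upper (y : R) : I01 y -> gstar g y <= 1 - y.
Proof.
  intros Hy. pose proof (inCc_le_chord _ (gstar_in_I01 y Hy)) as H.
  rewrite gstar_right_inv in H by exact Hy. lra.
Qed.

Lemma gstar_lower (a y : R) :
  0 < a <= 1 -> above a g -> I01 y -> a * (1 - y) <= gstar g y.
Proof.
  intros Ha H Hy. destruct Hy.
  assert (I : I01 (a * (1 - y))) by (unfold I01; nra).
  apply gstar_ge; auto. specialize (H _ I).
  apply Rmult_le_reg_l with a; lra.
Qed.

(** Strict decrease at positive levels gives g (x + eps/2) < y < g (x - eps/2), and monotonicity
    keeps the inverse of every nearby level between the two abscissas. An abscissa outside [0, 1]
    bounds it trivially. *)
Lemma gstar_cont (y : R) : 0 < y <= 1 -> forall eps, 0 < eps ->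
  exists delta, 0 < delta /\
    forall z, I01 z -> Rabs (z - y) < delta -> Rabs (gstar g z - gstar g y) < eps.
Proof.
  intros Hy eps Heps. assert (Iy : I01 y) by (unfold I01; lra).
  pose proof (gstar_right_inv y Iy) as Ey. pose proof (gstar_in_I01 y Iy) as Ih.
  set (x := gstar g y) in *. destruct Ih as [Hx0 Hx1].
  assert (U : exists d, 0 < d /\ forall z, I01 z -> y - d < z -> gstar g z <= x + eps / 2).
  { destruct (Rle_dec (x + eps / 2) 1) as [L|L].
    - exists (y - g (x + eps / 2)). split.
      + pose proof (inCc_strict x (x + eps / 2) Hx0 ltac:(lra) L). lra.
      + intros z Hz Hzy. destruct Hz.
        pose proof (proj2 g_unit_dec (x + eps / 2) ltac:(unfold I01; lra)).
        apply gstar_le_of_le; lra.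
    - exists 1. split; [lra|]. intros z Hz _.
      pose proof (proj2 (gstar_in_I01 z Hz)). lra. }
  assert (L : exists d, 0 < d /\ forall z, I01 z -> z < y + d -> x - eps / 2 <= gstar g z).
  { destruct (Rle_dec 0 (x - eps / 2)) as [L|L].
    - assert (P : y < g (x - eps / 2)).
      { pose proof (proj1 g_unit_dec (x - eps / 2) x).
        pose proof (inCc_strict (x - eps / 2) x L ltac:(lra) Hx1). lra. }
      exists (g (x - eps / 2) - y). split; [lra|].
      intros z Hz Hzy. destruct Hz. apply gstar_ge; auto; [unfold I01|]; lra.
    - exists 1. split; [lra|]. intros z Hz _.
      pose proof (proj1 (gstar_in_I01 z Hz)). lra. }
  destruct U as (d1 & Hd1 & U), L as (d2 & Hd2 & L).
  exists (Rmin d1 d2). split; [now apply Rmin_glb_lt|].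
  intros z Hz Hzy. apply Rabs_def2 in Hzy.
  pose proof (Rmin_l d1 d2). pose proof (Rmin_r d1 d2).
  specialize (U z Hz ltac:(lra)). specialize (L z Hz ltac:(lra)).
  apply Rabs_def1; lra.
Qed.

End Inverse.

(** * The integral of T g *)

(** The integrand x h x is not monotone, but x (1 - h x) is increasing as a product of nonnegative
    increasing factors, which makes x h x a difference of two decreasing functions. *)
Lemma ex_RInt_moment (h : R -> R) : unit_dec h -> ex_RInt (fun x => x * h x) 0 1.
Proof.
  intros Hh. apply ex_RInt_ext with (fun x => (1 - x * (1 - h x)) - (1 - x)).
  { intros x _. change (1 - x * (1 - h x) - (1 - x) = x * h x). ring. }
  apply ex_RInt_Rminus; apply ex_RInt_unit_dec.
  - split.
    + intros x y ? ? ?. pose proof (proj1 Hh x y).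
      pose proof (proj2 Hh x ltac:(unfold I01; lra)). nra.
    + intros x Hx. pose proof (proj2 Hh x Hx). destruct Hx. nra.
  - split; [intros x y; lra | unfold I01; intros; lra].
Qed.

Lemma RInt_mul_l (h : R -> R) (a b c : R) :
  ex_RInt h a b -> RInt (fun x => c * h x) a b = c * RInt h a b.
Proof. apply (RInt_scal (V := R_CompleteNormedModule)). Qed.

Lemma ex_RInt_mul_l (h : R -> R) (a b c : R) :
  ex_RInt h a b -> ex_RInt (fun x => c * h x) a b.
Proof. apply (ex_RInt_scal (V := R_NormedModule)). Qed.

Lemma integ_tail (h : R -> R) :
  unit_dec h -> RInt (tail h) 0 1 = RInt (fun x => x * h x) 0 1.
Proof.
  intros Hh. pose proof (tail_unit_dec h Hh) as Ht.
  pose proof (ex_RInt_unit_dec h Hh) as Ih. pose proof (ex_RInt_unit_dec _ Ht) as It.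
  pose proof (ex_RInt_moment h Hh) as Im. set (m := fun x => x * h x) in *.
  (* Integration by parts on [0, t] would say that F vanishes; comparing each integral over [s, t]
     with endpoint values bounds the increments of F by (t - s) (tail h s - tail h t). *)
  pose (F := fun t => RInt (tail h) 0 t - t * tail h t - RInt m 0 t).
  assert (E : F 1 = F 0).
  { apply (increments_const F (tail h)). intros s t Hs Hst Hu. unfold F.
    rewrite (RInt_split (tail h) 0 s t), (RInt_split m 0 s t) by (auto; lra).
    assert (A : (t - s) * tail h t <= RInt (tail h) s t <= (t - s) * tail h s).
    { split; [apply RInt_lower | apply RInt_upper]; auto; intros u Hx; apply Ht; lra. }
    assert (D : RInt h s t = tail h s - tail h t).
    { unfold tail. rewrite (RInt_split h s t 1) by (auto; lra). lra. }
    assert (Ist : ex_RInt h s t) by (apply ex_RInt_sub; auto).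
    assert (B : s * (tail h s - tail h t) <= RInt m s t <= t * (tail h s - tail h t)).
    { rewrite <- D, <- !RInt_mul_l by exact Ist.
      assert (Imst : ex_RInt m s t) by (apply ex_RInt_sub; auto).
      split; (apply RInt_le;
        [exact Hst | first [exact Imst | now apply ex_RInt_mul_l]
                   | first [exact Imst | now apply ex_RInt_mul_l] |]);
        intros u Hx; unfold m; pose proof (proj2 Hh u ltac:(unfold I01; lra));
        apply Rmult_le_compat_r; lra. }
    apply Rabs_le. lra. }
  unfold F in E. rewrite tail_1, !RInt_point in E. change (zero : R) with 0 in E. lra.
Qed.

Lemma RInt_quadratic (r A B a b : R) :
  let P := fun y => A * (y ^ 2 / 2 - r * y) - B * (y ^ 3 / 3 - r * y ^ 2 / 2) in
  is_RInt (fun y => (y - r) * (A - B * y)) a b (P b - P a).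
Proof.
  intros P. apply (is_RInt_derive (V := R_CompleteNormedModule) P).
  - intros x _. unfold P. auto_derive; [exact I|]. field.
  - intros x _. apply (ex_derive_continuous (V := R_NormedModule)). auto_derive. exact I.
Qed.

(* By convexity h lies below the line through (0, 1) and (r, h r) on [0, r] and
   above it on [r, 1], while h y >= a (1 - y). Hence (y - r) h y is smallest in the
   mean for the maximum of the two lines, which cross at s; the resulting lower bound
   a (1/6 - r/2) + (1 - a) (s^2/6 - r s/2) is minimal at s = 3 r / 2. *)
Lemma moment_lower (h : R -> R) (a r : R) :
  unit_dec h -> convex01 h -> h 0 = 1 ->
  (forall y, I01 y -> a * (1 - y) <= h y <= 1 - y) ->
  0 < a <= 1 / 5 -> r = 51 / 50 * a ->
  r * RInt h 0 1 <= RInt (fun y => y * h y) 0 1.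
Proof.
  intros Hu Hc h0 Hb Ha Hr.
  pose proof (ex_RInt_unit_dec h Hu) as Ih. pose proof (ex_RInt_moment h Hu) as Im.
  pose (w := fun y => y * h y - r * h y).
  assert (Iw : ex_RInt w 0 1) by (apply ex_RInt_Rminus; auto; now apply ex_RInt_mul_l).
  cut (0 <= RInt w 0 1).
  { unfold w. rewrite RInt_sub, RInt_mul_l; auto; [lra | now apply ex_RInt_mul_l]. }
  assert (Ir : I01 r) by (unfold I01; lra).
  pose proof (Hb r Ir) as Hp. set (p := h r) in *.
  pose (c := (1 - p) / r).
  assert (Ec : c * r = 1 - p) by (unfold c; field; lra).
  assert (Hc1 : 1 <= c) by nra.
  (* The abscissa where 1 - c y meets a (1 - y). It is at least r because at r the first line takes
     the value p >= a (1 - r). *)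
  pose (s := (1 - a) / (c - a)).
  assert (Es : (c - a) * s = 1 - a) by (unfold s; field; lra).
  assert (Hs0 : 0 < s) by (apply Rdiv_lt_0_compat; lra).
  assert (Hs1 : s <= 1) by nra.
  assert (Hrs : r <= s).
  { apply Rmult_le_reg_l with (c - a); [lra|]. rewrite Es. nra. }
  assert (C1 : forall y, 0 <= y <= r -> h y <= 1 - c * y).
  { intros y Hy. pose proof (Hc 0 r (y / r) ltac:(unfold I01; lra) Ir) as C.
    assert (E : y / r * r = y) by (field; lra).
    assert (0 <= y / r) by (apply Rmult_le_pos; [|left; apply Rinv_0_lt_compat]; lra).
    assert (y / r <= 1) by nra.
    specialize (C ltac:(unfold I01; lra)).
    replace ((1 - y / r) * 0 + y / r * r) with y in C by lra.
    rewrite h0 in C. fold p in C. replace (c * y) with (y / r * (c * r)) by (field; lra).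
    rewrite Ec. lra. }
  assert (C2 : forall y, r <= y <= 1 -> 1 - c * y <= h y).
  { intros y Hy. pose proof (Hc 0 y (r / y) ltac:(unfold I01; lra) ltac:(unfold I01; lra)) as C.
    assert (E : r / y * y = r) by (field; lra).
    assert (0 < r / y) by (apply Rdiv_lt_0_compat; lra).
    assert (r / y <= 1) by nra.
    specialize (C ltac:(unfold I01; lra)).
    replace ((1 - r / y) * 0 + r / y * y) with r in C by lra.
    rewrite h0 in C. fold p in C.
    apply Rmult_le_reg_l with (r / y); [lra|].
    replace (r / y * (1 - c * y)) with (r / y - c * r) by (field; lra). lra. }
  rewrite (RInt_split w 0 s 1) by (auto; lra).
  pose proof (RInt_quadratic r 1 c 0 s) as Q1. pose proof (RInt_quadratic r a a s 1) as Q2.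
  assert (B1 : RInt (fun y => (y - r) * (1 - c * y)) 0 s <= RInt w 0 s).
  { apply RInt_le; [lra | eexists; exact Q1 | apply ex_RInt_sub; auto; lra|].
    intros y Hy. unfold w. destruct (Rle_dec y r).
    - specialize (C1 y). nra.
    - specialize (C2 y). nra. }
  assert (B2 : RInt (fun y => (y - r) * (a - a * y)) s 1 <= RInt w s 1).
  { apply RInt_le; [lra | eexists; exact Q2 | apply ex_RInt_sub; auto; lra|].
    intros y Hy. unfold w. pose proof (Hb y ltac:(unfold I01; lra)). nra. }
  cbv beta zeta in Q1, Q2.
  apply (is_RInt_unique (V := R_CompleteNormedModule)) in Q1, Q2. rewrite Q1 in B1. rewrite Q2 in B2.
  (* The contributions of both antiderivatives at s; the relation (c - a) s = 1 - a eliminates c and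
     lowers the degree in s to 2. *)
  assert (V : (1 * (s ^ 2 / 2 - r * s) - c * (s ^ 3 / 3 - r * s ^ 2 / 2)) -
              (a * (s ^ 2 / 2 - r * s) - a * (s ^ 3 / 3 - r * s ^ 2 / 2)) =
              (1 - a) * (s ^ 2 / 6 - r * s / 2)).
  { transitivity ((1 - a) * (s ^ 2 / 2 - r * s) - (c - a) * s * (s ^ 2 / 3 - r * s / 2)).
    - field.
    - rewrite Es. field. }
  assert (M : - (3 * r ^ 2 / 8) <= s ^ 2 / 6 - r * s / 2).
  { pose proof (pow2_ge_0 (s - 3 / 2 * r)). nra. }
  (* Divided by a, the right side decreases in a, so a = 1/5 is the critical case; there about 0.002
     remains, and the factor 1.04 in place of 51/50 would fail. *)
  assert (N : 0 <= a * (1 / 6 - r / 2) - (1 - a) * (3 * r ^ 2 / 8)).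
  { rewrite Hr. replace (a * (1 / 6 - 51 / 50 * a / 2) - (1 - a) * (3 * (51 / 50 * a) ^ 2 / 8))
      with (a * (1 / 6 - 51 / 100 * a - (1 - a) * (7803 / 20000 * a))) by field.
    apply Rmult_le_pos; nra. }
  assert ((1 - a) * - (3 * r ^ 2 / 8) <= (1 - a) * (s ^ 2 / 6 - r * s / 2))
    by (apply Rmult_le_compat_l; lra).
  lra.
Qed.

Lemma integ_T_lower (g : R -> R) (a : R) :
  inCc g -> 0 < a <= 1 / 5 -> above a g -> 51 / 50 * a <= integ (T g).
Proof.
  intros Hg Ha Hab.
  assert (HE : inE g) by apply Hg. assert (g0 : g 0 = 1) by apply Hg.
  assert (HI : 0 < integ g) by apply Hg.
  pose proof (gstar_unit_dec g g0) as Hh.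
  pose proof (moment_lower (gstar g) a (51 / 50 * a) Hh (gstar_convex g Hg)
                (gstar_at_0 g Hg)) as M.
  specialize (M ltac:(intros y Hy; split;
    [apply gstar_lower; auto; lra | now apply gstar_upper]) Ha eq_refl).
  rewrite <- integ_tail in M by exact Hh.
  rewrite integ_gstar in M by (auto; now apply inE_unit_dec).
  assert (E : integ (T g) = / integ g * RInt (tail (gstar g)) 0 1).
  { unfold integ at 1. rewrite <- RInt_mul_l by (apply ex_RInt_unit_dec, tail_unit_dec, Hh).
    apply RInt_ext. intros x _. rewrite T_tail. apply Rmult_comm. }
  rewrite E. apply Rmult_le_reg_l with (integ g); [lra|].
  rewrite <- (Rmult_assoc _ (/ _)), Rinv_r by lra. lra.
Qed.

(** * Growth of stride and integral under T *)

Lemma T_above (f : R -> R) : inE f -> above (integ f) (T f).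
Proof.
  intros Hf x Hx. pose proof (T_lower f x Hf Hx) as H.
  assert (HI : 0 < integ f) by apply Hf.
  apply (Rmult_le_compat_l (integ f)) in H; [|lra].
  replace (integ f * (1 - x / integ f)) with (integ f - x) in H by (field; lra). lra.
Qed.

Lemma above_mono (a b : R) (g : R -> R) :
  inCc g -> b <= a -> above a g -> above b g.
Proof.
  intros Hg Hba H x Hx. specialize (H x Hx).
  assert (g x <= 1) by (apply (inE_unit_dec g); [apply Hg | exact Hx]). nra.
Qed.

(** The analogue of K with threshold a in place of 1/5; one parameter serves both bounds because
    each is recovered from the other. *)
Definition inP (a : R) (g : R -> R) : Prop := inCc g /\ above a g /\ a <= integ g.

Lemma T_inP (a : R) (g : R -> R) :
  0 < a <= 1 / 5 -> inP a g -> inP a (T g) /\ 51 / 50 * a <= integ (T g).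
Proof.
  intros Ha (Hg & Hab & HI).
  assert (HE : inE g) by apply Hg. pose proof (T_inCc g HE) as HT.
  pose proof (integ_T_lower g a Hg Ha Hab).
  split; [|assumption]. split; [exact HT|]. split; [|lra].
  apply above_mono with (integ g); auto. now apply T_above.
Qed.

(** The first application raises the integral to 51/50 a, the second turns that integral into a
    stride; the new integral is controlled by the stride bound a of T g. *)
Lemma TT_inP (a : R) (g : R -> R) :
  0 < a <= 1 / 5 -> inP a g -> inP (51 / 50 * a) (T (T g)).
Proof.
  intros Ha Hg. destruct (T_inP a g Ha Hg) as [H1 I1].
  destruct (T_inP a (T g) Ha H1) as [H2 I2].
  assert (HE : inE (T g)) by apply H1.
  split; [apply H2|]. split; [|exact I2].
  apply above_mono with (integ (T g)); [apply H2 | exact I1 | now apply T_above].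
Qed.

Lemma inP_mono (a b : R) (g : R -> R) : b <= a -> inP a g -> inP b g.
Proof.
  intros Hba (Hg & Hab & HI). split; [exact Hg|]. split; [|lra].
  now apply above_mono with a.
Qed.

Lemma inK_iff (g : R -> R) : inK g <-> inP (1 / 5) g.
Proof.
  unfold inK, inP. split; intros (Hg & H & HI); (split; [exact Hg|]; split; [|exact HI]).
  - intros x Hx. apply Rnot_lt_le. intro K.
    pose (D := 1 - g x).
    assert (HD : 0 < D) by (unfold D; destruct Hx; nra).
    destruct Hx as [Hx0 Hx1].
    (* A point x with g x < 1 caps the stride at x / (1 - g x), so a violation of [above] at x would
       push the stride below 1/5. *)
    pose proof (proj2 (Lub_Rbar_correct
      (fun a => 0 <= a /\ forall x, I01 x -> a - x <= a * g x)) (x / D)) as L.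
    assert (B : Rbar_le (1 / 5) (x / D)).
    { eapply Rbar_le_trans; [exact H|]. apply L. intros a [Ha Hab]. simpl.
      specialize (Hab x ltac:(unfold I01; lra)).
      apply Rmult_le_reg_r with D; [lra|].
      replace (x / D * D) with x by (field; lra). unfold D. lra. }
    simpl in B. apply (Rmult_le_compat_r D) in B; [|lra].
    replace (x / D * D) with x in B by (field; lra). unfold D in B. lra.
  - apply (proj1 (Lub_Rbar_correct _)). split; [lra|]. intros x Hx.
    specialize (H x Hx). lra.
Qed.

Lemma T_inK (g : R -> R) : inK g -> inK (T g).
Proof. rewrite !inK_iff. intros Hg. apply (T_inP (1 / 5)); [lra | exact Hg]. Qed.

Lemma eventually_inK (f : R -> R) :
  inE f -> exists n : nat, (1 <= n)%nat /\ inK (Titer n f).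
Proof.
  intros Hf. pose proof (T_inCc f Hf) as HT.
  assert (HI : 0 < integ f) by apply Hf. pose proof (T_integ_pos f Hf) as HIT.
  (* One application makes f convex and continuous, with stride at least int f; a is a common
     starting threshold, capped at 1/5 where the growth estimate stops. *)
  pose (a := Rmin (1 / 5) (Rmin (integ f) (integ (T f)))).
  assert (Ha : 0 < a) by (unfold a; repeat apply Rmin_glb_lt; lra).
  assert (Pa : inP a (T f)).
  { assert (a <= integ f).
    { eapply Rle_trans; [apply Rmin_r | apply Rmin_l]. }
    assert (a <= integ (T f)).
    { eapply Rle_trans; [apply Rmin_r | apply Rmin_r]. }
    split; [exact HT|]. split; [|assumption].
    apply above_mono with (integ f); auto. now apply T_above. }
  assert (K : forall k, inP (Rmin (1 / 5) ((51 / 50) ^ k * a)) (Titer (1 + 2 * k) f)).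
  { induction k as [|k IH].
    - apply inP_mono with a; [|exact Pa]. eapply Rle_trans; [apply Rmin_r|]. simpl. lra.
    - replace (1 + 2 * S k)%nat with (S (S (1 + 2 * k))) by lia.
      change (Titer (S (S (1 + 2 * k))) f) with (T (T (Titer (1 + 2 * k) f))).
      set (b := (51 / 50) ^ k * a) in *.
      assert (Hb : 0 < b) by (apply Rmult_lt_0_compat; [apply pow_lt|]; lra).
      apply inP_mono with (51 / 50 * Rmin (1 / 5) b).
      + cbn [pow]. rewrite Rmult_assoc. fold b.
        unfold Rmin. destruct (Rle_dec _ b), (Rle_dec _ (51 / 50 * b)); lra.
      + apply TT_inP; [|exact IH]. split; [apply Rmin_glb_lt; lra | apply Rmin_l]. }
  destruct (Pow_x_infinity (51 / 50) ltac:(rewrite Rabs_right; lra) (1 / 5 / a)) as [k Hk].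
  specialize (Hk k (le_n k)). rewrite Rabs_right in Hk by (apply Rle_ge, pow_le; lra).
  exists (1 + 2 * k)%nat. split; [lia|]. apply inK_iff.
  specialize (K k). rewrite Rmin_left in K; [exact K|].
  apply Rge_le in Hk. apply (Rmult_le_compat_r a) in Hk; [|lra].
  replace (1 / 5 / a * a) with (1 / 5) in Hk by (field; lra). exact Hk.
Qed.

(** The derivative of T g is - g^* / int g: continuous on (0, 1] because g^* is, zero at 1 because
    g^* y <= 1 - y, and convergent at 0 by monotonicity. *)
Lemma T_inDsharpc (g : R -> R) : inK g -> inDsharpc (T g).
Proof.
  intros HK. apply inK_iff in HK. destruct HK as (Hg & Hab & _).
  assert (HE : inE g) by apply Hg. pose proof (T_inCc g HE) as HT.
  assert (g0 : g 0 = 1) by apply Hg. assert (HI : 0 < integ g) by apply Hg.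
  pose proof (gstar_unit_dec g g0) as Hh.
  assert (Hi : 0 < / integ g) by now apply Rinv_0_lt_compat.
  assert (SC : forall u v eps, 0 < eps -> Rabs (u - v) < eps * integ g ->
                 Rabs (- u / integ g - - v / integ g) < eps).
  { intros u v eps He H. replace (- u / integ g - - v / integ g)
      with ((v - u) * / integ g) by (field; lra).
    rewrite Rabs_mult, (Rabs_right (/ integ g)), Rabs_minus_sym by lra.
    apply Rmult_lt_reg_r with (integ g); [lra|]. rewrite Rmult_assoc, Rinv_l by lra. lra. }
  split; [|exact HT]. split.
  { split; [apply HT|]. intros x y Hx Hxy Hy. rewrite !T_tail.
    apply Rmult_lt_compat_r; [lra|].
    (* The midpoint stays below 1, so g^* is positive there; at y itself it may vanish. *)
    pose proof (proj1 (tail_diff _ Hh x ((x + y) / 2) Hx ltac:(lra) ltac:(lra))) as A.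
    pose proof (proj1 (tail_unit_dec _ Hh) ((x + y) / 2) y ltac:(lra) ltac:(lra) Hy).
    pose proof (gstar_lower g Hg (1 / 5) ((x + y) / 2) ltac:(lra) Hab ltac:(unfold I01; lra)).
    assert (0 < ((x + y) / 2 - x) * gstar g ((x + y) / 2)) by (apply Rmult_lt_0_compat; lra).
    lra. }
  exists (fun x => - gstar g x / integ g). split; [split|split].
  - intros x Hx eps He.
    destruct (gstar_cont g Hg x Hx (eps * integ g) ltac:(nra)) as (d & Hd & H).
    exists d. split; [exact Hd|]. intros y Hy Hyx Hdist. specialize (H y Hy Hdist).
    (* By [tail_diff], q lies between g^* x and g^* y, so it is no further from g^* x than g^* y
       is. *)
    pose (q := - (tail (gstar g) y - tail (gstar g) x) / (y - x)).
    replace ((T g y - T g x) / (y - x)) with (- q / integ g)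
      by (rewrite !T_tail; unfold q; field; lra).
    apply SC; [exact He|]. eapply Rle_lt_trans; [|exact H].
    assert (Eq : q * (y - x) = tail (gstar g) x - tail (gstar g) y)
      by (unfold q; field; lra).
    destruct Hy. destruct (Rtotal_order x y) as [L|[L|L]]; [|lra|].
    + pose proof (tail_diff _ Hh x y) as A.
      assert (gstar g y <= q) by (apply Rmult_le_reg_r with (y - x); lra).
      assert (q <= gstar g x) by (apply Rmult_le_reg_r with (y - x); lra).
      rewrite (Rabs_left1 (q - _)), (Rabs_left1 (_ - _)); lra.
    + pose proof (tail_diff _ Hh y x) as A.
      assert (q <= gstar g y) by (apply Rmult_le_reg_r with (x - y); lra).
      assert (gstar g x <= q) by (apply Rmult_le_reg_r with (x - y); lra).
      rewrite (Rabs_right (q - _)), (Rabs_right (_ - _)); lra.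
  - intros x Hx eps He.
    destruct (gstar_cont g Hg x Hx (eps * integ g) ltac:(nra)) as (d & Hd & H).
    exists d. split; [exact Hd|]. intros y Hy Hdist. apply SC; [exact He|].
    apply H; [unfold I01; lra | exact Hdist].
  - pose proof (gstar_upper g Hg 1 ltac:(unfold I01; lra)).
    pose proof (proj2 Hh 1 ltac:(unfold I01; lra)).
    replace (gstar g 1) with 0 by lra. unfold Rdiv. ring.
  (* The limit at 0 is the supremum over positive levels; it differs from [gstar g 0] when g
     vanishes before 1. *)
  - destruct (completeness (fun v => exists y, 0 < y <= 1 /\ v = gstar g y)) as [l [Hub Hlub]].
    + exists 1. intros v (y & Hy & ->). apply Hh. unfold I01. lra.
    + exists (gstar g 1), 1. split; [lra | reflexivity].
    + exists (- l / integ g). split.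
      { assert (0 <= l).
        { eapply Rle_trans; [apply (proj2 Hh 1); unfold I01; lra|].
          apply Hub. exists 1. split; [lra | reflexivity]. }
        unfold Rdiv. nra. }
      intros eps He.
      assert (HN : exists y, 0 < y <= 1 /\ l - eps * integ g < gstar g y).
      { apply NNPP. intro N. assert (l <= l - eps * integ g); [|nra].
        apply Hlub. intros v (y & Hy & ->). apply Rnot_lt_le. intro L.
        apply N. exists y. split; assumption. }
      destruct HN as (y & Hy & Hly). exists y. split; [lra|].
      intros z Hz Hzy. apply SC; [exact He|].
      assert (gstar g z <= l) by (apply Hub; exists z; split; [exact Hz | reflexivity]).
      pose proof (proj1 Hh z y ltac:(lra) ltac:(lra) ltac:(lra)).
      apply Rabs_def1; nra.
Qed.

(** * The two metrics *)

Section Metrics.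

Variables f g : R -> R.
Hypotheses (Hf : unit_dec f) (Hg : unit_dec g).

Let E := fun r => exists x, I01 x /\ r = Rabs (f x - g x).

Lemma distinf_is_lub : is_lub_Rbar E (Finite (distinf f g)).
Proof.
  pose proof (Lub_Rbar_correct E) as [Hub Hlub].
  assert (H0 : Rbar_le (Rabs (f 0 - g 0)) (Lub_Rbar E)).
  { apply Hub. exists 0. split; [unfold I01; lra | reflexivity]. }
  assert (H1 : Rbar_le (Lub_Rbar E) 1).
  { apply Hlub. intros r (x & Hx & ->). simpl.
    pose proof (proj2 Hf x Hx). pose proof (proj2 Hg x Hx). apply Rabs_le. lra. }
  unfold distinf. fold E.
  destruct (Lub_Rbar E) as [r| |]; simpl in *; try tauto. now split.
Qed.

Lemma distinf_ge (x : R) : I01 x -> Rabs (f x - g x) <= distinf f g.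
Proof. intros Hx. apply (proj1 distinf_is_lub). now exists x. Qed.

Lemma distinf_le (M : R) :
  (forall x, I01 x -> Rabs (f x - g x) <= M) -> distinf f g <= M.
Proof. intros H. apply (proj2 distinf_is_lub M). intros r (x & Hx & ->). now apply H. Qed.

Lemma ex_RInt_dist : ex_RInt (fun x => Rabs (f x - g x)) 0 1.
Proof. apply ex_RInt_norm, ex_RInt_Rminus; now apply ex_RInt_unit_dec. Qed.

Lemma dist1_le_distinf : dist1 f g <= distinf f g.
Proof.
  unfold dist1. assert (RInt (fun x => Rabs (f x - g x)) 0 1 <= (1 - 0) * distinf f g); [|lra].
  apply RInt_upper; [apply ex_RInt_dist | lra | lra | lra |].
  intros x Hx. apply distinf_ge. unfold I01. lra.
Qed.

(** Lets both metrics be treated at once: hypotheses are weakened to [dist1], conclusions are proved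
    for [distinf]. *)
Lemma is_metric_bounds (d : (R -> R) -> (R -> R) -> R) :
  is_metric d -> dist1 f g <= d f g <= distinf f g.
Proof. pose proof dist1_le_distinf. intros [-> | ->]; lra. Qed.

Lemma integ_diff_le : Rabs (integ f - integ g) <= dist1 f g.
Proof.
  pose proof (ex_RInt_unit_dec f Hf). pose proof (ex_RInt_unit_dec g Hg).
  unfold integ, dist1. rewrite <- RInt_sub by assumption.
  apply abs_RInt_le; [lra | now apply ex_RInt_Rminus].
Qed.

End Metrics.

Lemma is_metric_triangle (d : (R -> R) -> (R -> R) -> R) (f g h : R -> R) :
  is_metric d -> unit_dec f -> unit_dec g -> unit_dec h -> d f h <= d f g + d g h.
Proof.
  intros Hd Hf Hg Hh.
  assert (T : forall x, Rabs (f x - h x) <= Rabs (f x - g x) + Rabs (g x - h x)).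
  { intros x. replace (f x - h x) with ((f x - g x) + (g x - h x)) by ring.
    apply Rabs_triang. }
  destruct Hd as [-> | ->].
  - apply distinf_le; auto. intros x Hx.
    pose proof (distinf_ge f g Hf Hg x Hx). pose proof (distinf_ge g h Hg Hh x Hx).
    specialize (T x). lra.
  - unfold dist1.
    rewrite <- (RInt_plus (V := R_CompleteNormedModule)) by now apply ex_RInt_dist.
    apply RInt_le; [lra | now apply ex_RInt_dist | | intros x _; apply T].
    apply (ex_RInt_plus (V := R_NormedModule)); now apply ex_RInt_dist.
Qed.

Lemma inK_unit_dec (g : R -> R) : inK g -> unit_dec g.
Proof. intros H. apply inE_unit_dec, H. Qed.

(** At x, g lies below the chord from (0, 1) to (y, g y), and the stride bound says that this chord
    has slope at least -5. *)
Lemma inK_lipschitz (g : R -> R) (x y : R) :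
  inK g -> 0 <= x -> x <= y -> y <= 1 -> g x - g y <= 5 * (y - x).
Proof.
  intros HK Hx Hxy Hy. apply inK_iff in HK. destruct HK as (Hg & Hab & _).
  assert (g0 : g 0 = 1) by apply Hg.
  destruct (Req_dec y 0) as [->|Ny]; [replace x with 0 by lra; lra|].
  pose proof (proj2 Hg 0 y (x / y) ltac:(unfold I01; lra) ltac:(unfold I01; lra)) as C.
  assert (E : x / y * y = x) by (field; lra).
  assert (0 <= x / y) by (apply Rmult_le_pos; [|left; apply Rinv_0_lt_compat]; lra).
  assert (x / y <= 1) by nra.
  specialize (C ltac:(unfold I01; lra)).
  replace ((1 - x / y) * 0 + x / y * y) with x in C by lra. rewrite g0 in C.
  specialize (Hab y ltac:(unfold I01; lra)).
  assert ((1 - x / y) * (1 - g y) <= (1 - x / y) * (5 * y))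
    by (apply Rmult_le_compat_l; lra).
  nra.
Qed.

Lemma inK_lipschitz_abs (g : R -> R) (x y : R) :
  inK g -> I01 x -> I01 y -> Rabs (g x - g y) <= 5 * Rabs (x - y).
Proof.
  intros HK [? ?] [? ?]. pose proof (proj1 (inK_unit_dec g HK)) as D.
  destruct (Rle_dec x y).
  - pose proof (inK_lipschitz g x y HK). pose proof (D x y).
    rewrite Rabs_right, Rabs_left1; lra.
  - pose proof (inK_lipschitz g y x HK). pose proof (D y x).
    rewrite Rabs_left1, Rabs_right; lra.
Qed.

(* If f - g = d at x, then f - g >= d / 2 on [x - d / 10, x], because f decreases
   and g is 5-Lipschitz. *)
Lemma inK_diff_sq_le (f g : R -> R) (x : R) :
  inK f -> inK g -> I01 x -> g x <= f x -> (f x - g x) ^ 2 <= 20 * dist1 f g.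
Proof.
  intros HKf HKg [Hx0 Hx1] Hle.
  pose proof (inK_unit_dec f HKf) as Hf. pose proof (inK_unit_dec g HKg) as Hg.
  pose proof (ex_RInt_dist f g Hf Hg) as Id.
  set (d := f x - g x).
  (* Ensures x - d / 10 >= 0. The interval of length d / 10 then contributes at least d^2 / 20 to
     the integral; the resulting 20 is below 25 = 5^2. *)
  assert (Hd : d <= 5 * x).
  { pose proof (inK_lipschitz g 0 x HKg ltac:(lra) Hx0 Hx1).
    assert (g 0 = 1) by apply HKg. pose proof (proj2 Hf x ltac:(unfold I01; lra)).
    unfold d. lra. }
  assert (0 <= d) by (unfold d; lra).
  unfold dist1. rewrite (RInt_split _ 0 (x - d / 10) 1) by (auto; lra).
  rewrite (RInt_split _ (x - d / 10) x 1) by (auto; lra).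
  set (k := fun u => Rabs (f u - g u)) in *.
  assert ((x - d / 10 - 0) * 0 <= RInt k 0 (x - d / 10)).
  { apply RInt_lower; auto; try lra. intros; apply Rabs_pos. }
  assert ((1 - x) * 0 <= RInt k x 1).
  { apply RInt_lower; auto; try lra. intros; apply Rabs_pos. }
  assert ((x - (x - d / 10)) * (d / 2) <= RInt k (x - d / 10) x).
  { apply RInt_lower; auto; try lra. intros u Hu. unfold k.
    pose proof (proj1 Hf u x ltac:(lra) ltac:(lra) Hx1).
    pose proof (inK_lipschitz g u x HKg ltac:(lra) ltac:(lra) Hx1).
    eapply Rle_trans; [|apply Rle_abs]. unfold d in *. lra. }
  nra.
Qed.

Lemma dist1_sym (f g : R -> R) : dist1 f g = dist1 g f.
Proof. apply RInt_ext. intros x _. apply Rabs_minus_sym. Qed.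

Lemma distinf_le_sqrt_dist1 (f g : R -> R) :
  inK f -> inK g -> distinf f g <= 5 * sqrt (dist1 f g).
Proof.
  intros HKf HKg.
  pose proof (inK_unit_dec f HKf) as Hf. pose proof (inK_unit_dec g HKg) as Hg.
  assert (H0 : 0 <= dist1 f g).
  { eapply Rle_trans; [apply Rabs_pos | now apply integ_diff_le]. }
  apply distinf_le; auto. intros x Hx.
  assert (S : (Rabs (f x - g x)) ^ 2 <= 20 * dist1 f g).
  { rewrite pow2_abs. destruct (Rle_dec (g x) (f x)).
    - now apply inK_diff_sq_le.
    - replace ((f x - g x) ^ 2) with ((g x - f x) ^ 2) by ring.
      rewrite dist1_sym. apply inK_diff_sq_le; auto; lra. }
  pose proof (sqrt_pos (dist1 f g)). pose proof (sqrt_sqrt _ H0) as Q.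
  apply Rnot_lt_le. intro K. nra.
Qed.

(* The layer-cake formula makes the tail integrals 1-Lipschitz for dist1. *)
Lemma T_diff_le (f g : R -> R) (x : R) :
  inK f -> inK g -> I01 x -> Rabs (T f x - T g x) <= 10 * dist1 f g.
Proof.
  intros HKf HKg Hx.
  pose proof (inK_unit_dec f HKf) as Hf. pose proof (inK_unit_dec g HKg) as Hg.
  assert (f0 : f 0 = 1) by apply HKf. assert (g0 : g 0 = 1) by apply HKg.
  assert (If : 1 / 5 <= integ f) by apply HKf. assert (Ig : 0 < integ g) by apply HKg.
  pose proof (integ_diff_le f g Hf Hg) as DI.
  assert (DH : Rabs (tail (gstar f) x - tail (gstar g) x) <= dist1 f g).
  { unfold tail. rewrite !layer_cake by assumption. destruct Hx.
    pose proof (ex_RInt_unit_dec _ (unit_dec_pos_part f x ltac:(lra) Hf)) as J1.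
    pose proof (ex_RInt_unit_dec _ (unit_dec_pos_part g x ltac:(lra) Hg)) as J2.
    rewrite <- RInt_sub by assumption.
    pose proof (ex_RInt_Rminus _ _ _ _ J1 J2) as J.
    eapply Rle_trans; [apply abs_RInt_le; [lra | exact J]|].
    apply RInt_le; [lra | now apply ex_RInt_norm | now apply ex_RInt_dist|].
    intros u _. unfold Rmax. destruct (Rle_dec (f u - x) 0), (Rle_dec (g u - x) 0);
      unfold Rabs; destruct (Rcase_abs _), (Rcase_abs _); lra. }
  pose proof (proj2 (T_unit_dec g ltac:(apply HKg)) x Hx) as HT.
  set (D := dist1 f g) in *.
  (* In this form only 1 / int f <= 5 is a factor. The two terms are each at most D, because 0 <= T
     g <= 1, whence 10 = 5 * 2. *)
  replace (T f x - T g x) with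
    (/ integ f * ((tail (gstar f) x - tail (gstar g) x) + T g x * (integ g - integ f)))
    by (rewrite !T_tail; field; lra).
  assert (Hi : 0 < / integ f) by (apply Rinv_0_lt_compat; lra).
  assert (Hi5 : / integ f <= 5).
  { replace 5 with (/ (1 / 5)) by field. apply Rinv_le_contravar; lra. }
  rewrite Rabs_mult, (Rabs_right (/ integ f)) by lra.
  assert (B : Rabs ((tail (gstar f) x - tail (gstar g) x) + T g x * (integ g - integ f))
              <= 2 * D).
  { eapply Rle_trans; [apply Rabs_triang|].
    rewrite Rabs_mult, (Rabs_right (T g x)), (Rabs_minus_sym (integ g)) by lra.
    pose proof (Rabs_pos (integ f - integ g)). nra. }
  set (q := Rabs _) in *. assert (0 <= q) by apply Rabs_pos. nra.
Qed.

(** * Compactness *)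

(** All conditions on K are non-strict inequalities or equalities stable under uniform limits,
    except continuity, which follows from the common Lipschitz constant 5. *)
Lemma inK_closed (g : R -> R) :
  (forall e, 0 < e -> exists f, inK f /\ forall x, I01 x -> Rabs (f x - g x) <= e) ->
  inK g.
Proof.
  intros H.
  assert (A : forall e, 0 < e -> exists f, inK f /\
                forall x, I01 x -> f x - e <= g x <= f x + e).
  { intros e He. destruct (H e He) as (f & Hf & Hx). exists f. split; [exact Hf|].
    intros x Ix. specialize (Hx x Ix). apply Rabs_le_between in Hx. lra. }
  assert (D : dec01 g).
  { intros x y ? ? ?. apply le_epsilon. intros e He.
    destruct (A (e / 2) ltac:(lra)) as (f & Hf & Hx).
    pose proof (proj1 (inK_unit_dec f Hf) x y). pose proof (Hx x ltac:(unfold I01; lra)).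
    pose proof (Hx y ltac:(unfold I01; lra)). lra. }
  assert (P : forall x, I01 x -> 0 <= g x).
  { intros x Ix. apply le_epsilon. intros e He.
    destruct (A e He) as (f & Hf & Hx). specialize (Hx x Ix).
    pose proof (proj2 (inK_unit_dec f Hf) x Ix). lra. }
  assert (g0 : g 0 = 1).
  { apply Rle_antisym; apply le_epsilon; intros e He;
      destruct (A e He) as (f & Hf & Hx); specialize (Hx 0 ltac:(unfold I01; lra));
      assert (f 0 = 1) by apply Hf; lra. }
  assert (g1 : g 1 = 0).
  { apply Rle_antisym; apply le_epsilon; intros e He;
      destruct (A e He) as (f & Hf & Hx); specialize (Hx 1 ltac:(unfold I01; lra));
      assert (f 1 = 0) by apply Hf; lra. }
  assert (Hu : unit_dec g).
  { split; [exact D|]. intros x Hx. split; [now apply P|]. rewrite <- g0.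
    destruct Hx. apply D; lra. }
  assert (I5 : 1 / 5 <= integ g).
  { apply le_epsilon. intros e He. destruct (H e He) as (f & Hf & Hx).
    pose proof (inK_unit_dec f Hf) as Hfu.
    pose proof (integ_diff_le f g Hfu Hu) as B.
    pose proof (dist1_le_distinf f g Hfu Hu). pose proof (distinf_le f g Hfu Hu e Hx).
    apply Rabs_le_between in B. assert (1 / 5 <= integ f) by apply Hf. lra. }
  apply inK_iff. split; [|split; [|exact I5]].
  - repeat split; auto; [lra| |].
    + intros x Ix eps He. exists (eps / 6). split; [lra|]. intros y Iy Hxy.
      assert (L : Rabs (g y - g x) <= 5 * Rabs (y - x)); [|lra].
      apply le_epsilon. intros e He'. destruct (H (e / 2) ltac:(lra)) as (f & Hf & Hx).
      pose proof (inK_lipschitz_abs f y x Hf Iy Ix) as L.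
      pose proof (Hx x Ix) as B1. pose proof (Hx y Iy) as B2.
      apply Rabs_le_between in L, B1, B2. apply Rabs_le. lra.
    + intros x y t Ix Iy It. apply le_epsilon. intros e He.
      destruct (A (e / 2) ltac:(lra)) as (f & Hf & Hx).
      assert (Iz : I01 ((1 - t) * x + t * y)) by (destruct Ix, Iy, It; unfold I01; nra).
      assert (C : convex01 f) by apply Hf. specialize (C x y t Ix Iy It).
      pose proof (Hx _ Iz). pose proof (Hx x Ix). pose proof (Hx y Iy). destruct It. nra.
  - intros x Ix. apply le_epsilon. intros e He.
    destruct (A e He) as (f & Hf & Hx). specialize (Hx x Ix).
    apply inK_iff in Hf. destruct Hf as (_ & Hab & _). specialize (Hab x Ix). lra.
Qed.

(** Subsequences are handled as infinite sets of indices: refining is passing to a subset, and an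
    actual index sequence is chosen only at the end. *)
Definition infinite (S : nat -> Prop) : Prop := forall N, exists n, (N <= n)%nat /\ S n.

Lemma infinite_split (S P : nat -> Prop) :
  infinite S -> infinite (fun n => S n /\ P n) \/ infinite (fun n => S n /\ ~ P n).
Proof.
  intros HS. apply NNPP. intro K. apply not_or_and in K. destruct K as [K1 K2].
  apply not_all_ex_not in K1, K2. destruct K1 as [N1 K1], K2 as [N2 K2].
  destruct (HS (max N1 N2)) as (n & Hn & Sn).
  destruct (classic (P n)).
  - apply K1. exists n. split; [lia | now split].
  - apply K2. exists n. split; [lia | now split].
Qed.

Lemma infinite_bisect (v : nat -> R) (k : nat) : forall (S : nat -> Prop) (a L : R),
  infinite S -> (forall n, S n -> a <= v n <= a + L) ->
  exists S', infinite S' /\ (forall n, S' n -> S n) /\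
    forall m n, S' m -> S' n -> Rabs (v m - v n) <= L / 2 ^ k.
Proof.
  induction k as [|k IH]; intros S a L HS Hv.
  - exists S. repeat split; auto. intros m n Hm Hn. apply Hv in Hm, Hn.
    apply Rabs_le. simpl. lra.
  - assert (E : L / 2 / 2 ^ k = L / 2 ^ (Datatypes.S k))
      by (simpl; field; apply pow_nonzero; lra).
    destruct (infinite_split S (fun n => v n <= a + L / 2) HS) as [K|K].
    + destruct (IH _ a (L / 2) K) as (S' & H1 & H2 & H3).
      { intros n [Sn Hn]. apply Hv in Sn. lra. }
      exists S'. rewrite <- E. repeat split; auto. intros n Hn. now apply H2 in Hn.
    + destruct (IH _ (a + L / 2) (L / 2) K) as (S' & H1 & H2 & H3).
      { intros n [Sn Hn]. apply Hv in Sn. lra. }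
      exists S'. rewrite <- E. repeat split; auto. intros n Hn. now apply H2 in Hn.
Qed.

Lemma infinite_close (v : nat -> R) (S : nat -> Prop) (eps : R) :
  0 < eps -> infinite S -> (forall n, 0 <= v n <= 1) ->
  exists S', infinite S' /\ (forall n, S' n -> S n) /\
    forall m n, S' m -> S' n -> Rabs (v m - v n) <= eps.
Proof.
  intros He HS Hv.
  destruct (Pow_x_infinity 2 ltac:(rewrite Rabs_right; lra) (/ eps)) as [k Hk].
  specialize (Hk k (le_n k)). assert (Hp : 0 < 2 ^ k) by (apply pow_lt; lra).
  rewrite Rabs_right in Hk by lra.
  destruct (infinite_bisect v k S 0 1 HS) as (S' & H1 & H2 & H3).
  { intros n _. specialize (Hv n). lra. }
  exists S'. repeat split; auto. intros m n Hm Hn.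
  eapply Rle_trans; [now apply H3|].
  apply Rmult_le_reg_r with (2 ^ k); [lra|]. replace (1 / 2 ^ k * 2 ^ k) with 1 by (field; lra).
  apply Rge_le, (Rmult_le_compat_l eps) in Hk; [|lra]. rewrite Rinv_r in Hk; lra.
Qed.

Lemma infinite_close_family (v : nat -> nat -> R) (eps : R) (k : nat) :
  forall S : nat -> Prop, 0 < eps -> infinite S -> (forall i n, 0 <= v i n <= 1) ->
  exists S', infinite S' /\ (forall n, S' n -> S n) /\
    forall i, (i < k)%nat -> forall m n, S' m -> S' n -> Rabs (v i m - v i n) <= eps.
Proof.
  induction k as [|k IH]; intros S He HS Hv.
  - exists S. repeat split; auto. intros i Hi. lia.
  - destruct (IH S He HS Hv) as (S1 & I1 & J1 & K1).
    destruct (infinite_close (v k) S1 eps He I1 (Hv k)) as (S2 & I2 & J2 & K2).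
    exists S2. repeat split; auto. intros i Hi m n Hm Hn.
    destruct (Nat.eq_dec i k) as [->|Hik]; [now apply K2|].
    apply K1; auto. lia.
Qed.

Lemma infinite_close_unif (u : nat -> R -> R) (S : nat -> Prop) (eps : R) :
  (forall n, inK (u n)) -> 0 < eps -> infinite S ->
  exists S', infinite S' /\ (forall n, S' n -> S n) /\
    forall m n, S' m -> S' n -> forall x, I01 x -> Rabs (u m x - u n x) <= eps.
Proof.
  intros HK He HS.
  (* With mesh below eps / 20 the Lipschitz constant 5 costs eps / 4 for each of the two functions,
     leaving eps / 2 at the N + 1 grid points. *)
  destruct (archimed_cor1 (eps / 20) ltac:(lra)) as (N & HN & HN0).
  assert (HNp : 0 < INR N) by now apply lt_0_INR.
  pose (pt := fun i => Rmin 1 (INR i / INR N)).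
  assert (Ipt : forall i, I01 (pt i)).
  { intros i. split; [|apply Rmin_l]. apply Rmin_glb; [lra|].
    apply Rmult_le_pos; [apply pos_INR | left; now apply Rinv_0_lt_compat]. }
  destruct (infinite_close_family (fun i n => u n (pt i)) (eps / 2) (Datatypes.S N) S
              ltac:(lra) HS) as (S' & H1 & H2 & H3).
  { intros i n. apply (inK_unit_dec _ (HK n)), Ipt. }
  exists S'. repeat split; auto. intros m n Hm Hn x Ix.
  destruct (nfloor_ex (x * INR N)) as [i [Hi1 Hi2]].
  { destruct Ix. nra. }
  assert (Hi : (i < Datatypes.S N)%nat).
  { apply INR_lt. rewrite S_INR. destruct Ix. nra. }
  assert (Ei : INR i / INR N * INR N = INR i) by (field; lra).
  assert (A1 : INR i / INR N <= x) by (apply Rmult_le_reg_r with (INR N); lra).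
  assert (A2 : x <= INR i / INR N + / INR N).
  { apply Rmult_le_reg_r with (INR N); [lra|].
    rewrite Rmult_plus_distr_r, Rinv_l; lra. }
  assert (Ep : pt i = INR i / INR N) by (unfold pt; apply Rmin_right; destruct Ix; lra).
  specialize (H3 i Hi m n Hm Hn). cbv beta in H3.
  pose proof (inK_lipschitz_abs _ x (pt i) (HK m) Ix (Ipt i)) as L1.
  pose proof (inK_lipschitz_abs _ x (pt i) (HK n) Ix (Ipt i)) as L2.
  assert (L3 : Rabs (x - pt i) <= eps / 20) by (rewrite Ep; apply Rabs_le; lra).
  assert (L4 : Rabs (u m x - u m (pt i)) <= eps / 4) by lra.
  assert (L5 : Rabs (u n x - u n (pt i)) <= eps / 4) by lra.
  apply Rabs_le_between in H3, L4, L5. apply Rabs_le. lra.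
Qed.

Lemma subsequence_unif_cauchy (u : nat -> R -> R) :
  (forall n, inK (u n)) ->
  exists phi : nat -> nat, (forall n, (phi n < phi (S n))%nat) /\
    forall k m n, (k <= m)%nat -> (k <= n)%nat -> forall x, I01 x ->
      Rabs (u (phi m) x - u (phi n) x) <= / INR (S k).
Proof.
  intros HK.
  assert (Hstep : forall (A : {S : nat -> Prop | infinite S}) (k : nat),
    exists B : {S : nat -> Prop | infinite S},
      (forall n, proj1_sig B n -> proj1_sig A n) /\
      forall m n, proj1_sig B m -> proj1_sig B n -> forall x, I01 x ->
        Rabs (u m x - u n x) <= / INR (S k)).
  { intros [A HA] k.
    destruct (infinite_close_unif u A (/ INR (S k)) HK) as (B & H1 & H2 & H3); auto.
    { apply Rinv_0_lt_compat, lt_0_INR. lia. }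
    exists (exist _ B H1). now split. }
  pose (next := fun A k => proj1_sig (constructive_indefinite_description _ (Hstep A k))).
  assert (Hnext : forall A k,
      (forall n, proj1_sig (next A k) n -> proj1_sig A n) /\
      forall m n, proj1_sig (next A k) m -> proj1_sig (next A k) n -> forall x, I01 x ->
        Rabs (u m x - u n x) <= / INR (S k)).
  { intros A k. apply (proj2_sig (constructive_indefinite_description _ (Hstep A k))). }
  assert (Hall : infinite (fun _ => True)) by (intros N; exists N; split; [lia | exact I]).
  (* A decreasing chain of infinite index sets with uniform oscillation at most 1/(k+1) on [Q k];
     the diagonal [phi] picks from each set an index beyond the previous one. *)
  pose (Q := fix Q k := match k with
                        | O => next (exist _ _ Hall) O
                        | S j => next (Q j) (S j)
                        end).
  assert (HQ : forall k m n, proj1_sig (Q k) m -> proj1_sig (Q k) n -> forall x, I01 x ->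
             Rabs (u m x - u n x) <= / INR (S k)).
  { intros [|k]; apply (proj2 (Hnext _ _)). }
  assert (Hmono : forall j k, (j <= k)%nat -> forall n, proj1_sig (Q k) n -> proj1_sig (Q j) n).
  { intros j k Hjk. induction Hjk as [|k Hjk IH]; auto.
    intros n Hn. apply IH. now apply (proj1 (Hnext (Q k) (S k))). }
  assert (Hpick : forall k N, exists n, (N <= n)%nat /\ proj1_sig (Q k) n)
    by (intros k; exact (proj2_sig (Q k))).
  pose (pick := fun k N => proj1_sig (constructive_indefinite_description _ (Hpick k N))).
  assert (Pp : forall k N, (N <= pick k N)%nat /\ proj1_sig (Q k) (pick k N)).
  { intros k N. apply (proj2_sig (constructive_indefinite_description _ (Hpick k N))). }
  pose (phi := fix phi k := match k with
                            | O => pick O O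
                            | S j => pick (S j) (S (phi j))
                            end).
  assert (Hphi : forall k, proj1_sig (Q k) (phi k)) by (intros [|k]; apply Pp).
  exists phi. split.
  - intros n. apply (Pp (S n) (S (phi n))).
  - intros k m n Hm Hn. apply HQ; [apply (Hmono k m Hm) | apply (Hmono k n Hn)]; apply Hphi.
Qed.

Lemma inK_compact (u : nat -> R -> R) :
  (forall n, inK (u n)) ->
  exists (phi : nat -> nat) g,
    (forall n, (phi n < phi (S n))%nat) /\ inK g /\
    forall eps, 0 < eps -> exists N, forall n, (N <= n)%nat -> distinf (u (phi n)) g < eps.
Proof.
  intros HK. destruct (subsequence_unif_cauchy u HK) as (phi & Hphi & HC).
  pose (g := fun x => real (Lim_seq (fun n => u (phi n) x))).
  assert (Hlim : forall x, I01 x -> is_lim_seq (fun n => u (phi n) x) (g x)).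
  { intros x Ix. apply Lim_seq_correct', ex_lim_seq_cauchy_corr.
    intros eps. destruct (archimed_cor1 eps (cond_pos eps)) as (N & HN & HN0).
    exists N. intros n m Hn Hm. eapply Rle_lt_trans; [now apply (HC N)|].
    eapply Rle_lt_trans; [|exact HN]. apply Rinv_le_contravar.
    - now apply lt_0_INR.
    - apply le_INR. lia. }
  assert (Hunif : forall k x, I01 x -> Rabs (u (phi k) x - g x) <= / INR (S k)).
  { intros k x Ix.
    (* Letting n tend to infinity in the Cauchy estimate, whose bound does not depend on x, makes
       the pointwise limit uniform. *)
    assert (L : is_lim_seq (fun n => Rabs (u (phi k) x - u (phi n) x))
                  (Rabs (u (phi k) x - g x))).
    { apply (is_lim_seq_abs _ (u (phi k) x - g x)).
      apply is_lim_seq_minus'; [apply is_lim_seq_const | now apply Hlim]. }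
    change (Rbar_le (Rabs (u (phi k) x - g x)) (/ INR (S k))).
    eapply is_lim_seq_le_loc with (v := fun _ => / INR (S k));
      [|exact L | apply is_lim_seq_const].
    exists k. intros n Hn. now apply (HC k). }
  assert (Hsmall : forall e, 0 < e -> exists N, forall n, (N <= n)%nat ->
             / INR (S n) < e).
  { intros e He. destruct (archimed_cor1 e He) as (N & HN & HN0).
    exists N. intros n Hn. eapply Rle_lt_trans; [|exact HN]. apply Rinv_le_contravar.
    - now apply lt_0_INR.
    - apply le_INR. lia. }
  assert (Hg : inK g).
  { apply inK_closed. intros e He. destruct (Hsmall e He) as [N HN].
    exists (u (phi N)). split; [apply HK|]. intros x Ix.
    left. eapply Rle_lt_trans; [now apply Hunif | now apply HN]. }
  exists phi, g. repeat split; auto; try apply Hg.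
  intros e He. destruct (Hsmall e He) as [N HN]. exists N. intros n Hn.
  eapply Rle_lt_trans; [|now apply (HN n)].
  apply distinf_le; auto using inK_unit_dec.
Qed.

Lemma inK_metric_compact (d : (R -> R) -> (R -> R) -> R) (u : nat -> R -> R) :
  is_metric d -> (forall n, inK (u n)) ->
  exists (phi : nat -> nat) g,
    (forall n, (phi n < phi (S n))%nat) /\ inK g /\
    forall eps, 0 < eps -> exists N, forall n, (N <= n)%nat -> d (u (phi n)) g < eps.
Proof.
  intros Hd HK. destruct (inK_compact u HK) as (phi & g & Hphi & Hg & H).
  exists phi, g. split; [exact Hphi|]. split; [exact Hg|].
  intros e He. destruct (H e He) as [N HN]. exists N. intros n Hn.
  eapply Rle_lt_trans; [|now apply (HN n)].
  apply is_metric_bounds; auto using inK_unit_dec.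
Qed.

Theorem theorem2p5 :
  (* (a) *)
  (forall g, inK g -> inK (T g) /\ inDsharpc (T g)) /\
  (* (b) *)
  (forall f, inE f -> exists n : nat, (1 <= n)%nat /\ inK (Titer n f)) /\
  (* (c) *)
  (forall f g, inK f -> inK g ->
     dist1 f g <= distinf f g /\ distinf f g <= 5 * sqrt (dist1 f g)) /\
  (* (d) completeness *)
  (forall d, is_metric d -> forall u : nat -> R -> R,
     (forall n, inK (u n)) ->
     (forall eps, 0 < eps -> exists N, forall m n, (N <= m)%nat -> (N <= n)%nat ->
        d (u m) (u n) < eps) ->
     exists g, inK g /\
       forall eps, 0 < eps -> exists N, forall n, (N <= n)%nat -> d (u n) g < eps) /\
  (* (e) continuity of T restricted to K *)
  (forall d d', is_metric d -> is_metric d' ->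
     forall f, inK f -> forall eps, 0 < eps -> exists delta, 0 < delta /\
       forall g, inK g -> d f g < delta -> d' (T f) (T g) < eps) /\
  (* (f) sequential compactness *)
  (forall d, is_metric d -> forall u : nat -> R -> R,
     (forall n, inK (u n)) ->
     exists (phi : nat -> nat) g,
       (forall n, (phi n < phi (S n))%nat) /\ inK g /\
       forall eps, 0 < eps -> exists N, forall n, (N <= n)%nat -> d (u (phi n)) g < eps).
Proof.
  split; [|split; [|split; [|split; [|split]]]].
  - intros g Hg. split; [now apply T_inK | now apply T_inDsharpc].
  - exact eventually_inK.
  - intros f g Hf Hg. split; [|now apply distinf_le_sqrt_dist1].
    apply dist1_le_distinf; now apply inK_unit_dec.
  - intros d Hd u HK HC.
    (* A Cauchy sequence with a convergent subsequence converges to the same limit, so completeness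
       follows from compactness. *)
    destruct (inK_metric_compact d u Hd HK) as (phi & g & Hphi & Hg & H).
    assert (Hge : forall n, (n <= phi n)%nat).
    { induction n as [|n IH]; [lia|]. specialize (Hphi n). lia. }
    exists g. split; [exact Hg|]. intros eps He.
    destruct (HC (eps / 2) ltac:(lra)) as [N1 H1].
    destruct (H (eps / 2) ltac:(lra)) as [N2 H2].
    exists N1. intros n Hn. pose (k := max N1 N2).
    specialize (H2 k ltac:(lia)).
    specialize (H1 n (phi k) Hn ltac:(specialize (Hge k); lia)).
    pose proof (is_metric_triangle d (u n) (u (phi k)) g Hd (inK_unit_dec _ (HK _))
                  (inK_unit_dec _ (HK _)) (inK_unit_dec _ Hg)). lra.
  - intros d d' Hd Hd' f Hf eps He. exists (eps / 10). split; [lra|]. intros g Hg Hfg.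
    pose proof (proj1 (is_metric_bounds f g (inK_unit_dec _ Hf) (inK_unit_dec _ Hg) d Hd)).
    assert (UT : unit_dec (T f) /\ unit_dec (T g)) by (split; apply inK_unit_dec, T_inK; auto).
    destruct UT as [UTf UTg].
    pose proof (proj2 (is_metric_bounds (T f) (T g) UTf UTg d' Hd')).
    pose proof (distinf_le (T f) (T g) UTf UTg (10 * dist1 f g)
                  (fun x Ix => T_diff_le f g x Hf Hg Ix)).
    lra.
  - intros d Hd u HK. now apply inK_metric_compact.
Qed.
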